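(* Let $n\ge1$ and $\pi\in S_\mathbb{Z}$. Then the Little bumping operator $\mathfrak b_\pi$, acting on factorizations, is an isomorphism of abstract $\mathfrak{gl}_n$-crystals $\bigsqcup_{\sigma\in S_\mathbb{Z}}\mathcal R_n(\sigma)\to\bigsqcup_{\sigma\in S_\mathbb{Z}}\mathcal R_n(\sigma)$.
   Context: $S_\mathbb{Z}$ is the group of permutations of $\mathbb{Z}$ fixing all but finitely many integers, generated by $s_i=(i,i+1)$. A reduced word for $\sigma\in S_\mathbb{Z}$ is a minimal-length sequence $i_1\cdots i_l$ with $\sigma=s_{i_1}\cdots s_{i_l}$; $\mathcal R(\sigma)$ is the set of these. $\mathcal R_n(\sigma)$ is the set of $n$-tuples $w=(w^1,\dots,w^n)$ of strictly increasing, possibly empty words with $w^1\cdots w^n\in\mathcal R(\sigma)$, with $\mathrm{wt}(w)=(\ell(w^1),\dots,\ell(w^n))$. For increasing words $a,b$, $\mathsf{pair}(a,b)$ is formed by iterating over letters $b_j$ of $b$ from largest to smallest, pairing $b_j$ with the smallest unpaired letter $a_i$ of $a$ with $a_i>b_j$, if one exists. For $i\in[n-1]$: $f_i(w)=0$ if every letter of $w^i$ is paired in $\mathsf{pair}(w^i,w^{i+1})$; otherwise $f_i(w)$ removes the largest unpaired letter $x$ of $w^i$ and adds to $w^{i+1}$ the smallest integer $y\ge x$ not already a letter of $w^{i+1}$. $e_i(w)=0$ if every letter of $w^{i+1}$ is paired; otherwise $e_i(w)$ removes the smallest unpaired letter $y$ of $w^{i+1}$ and adds to $w^i$ the largest integer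 $x\le y$ not already a letter of $w^i$. It is known that these make $\mathcal R_n(\sigma)$ an abstract $\mathfrak{gl}_n$-crystal (a set $\mathcal B$ with $\mathrm{wt}:\mathcal B\to\mathbb{Z}^n_{\ge0}$, $e_i,f_i:\mathcal B\to\mathcal B\sqcup\{0\}$ with $e_i(b)=c\iff f_i(c)=b$, then $\mathrm{wt}(c)=\mathrm{wt}(b)+\mathbf e_i-\mathbf e_{i+1}$, and finite string lengths $\varepsilon_i,\varphi_i$ with $\varphi_i-\varepsilon_i=\mathrm{wt}_i-\mathrm{wt}_{i+1}$); an isomorphism is a bijection of $\mathcal B\sqcup\{0\}$ onto $\mathcal C\sqcup\{0\}$ with $0\mapsto 0$ preserving weights and string lengths and commuting with all $e_i,f_i$. Little bumps: for a word $w$ and index $i$, $\mathrm{del}_i(w)$ omits the $i$th letter; $(w,i)$ is a $\pi$-marked word if $\mathrm{del}_i(w)\in\mathcal R(\pi)$; it is reduced if $w$ is a reduced word. It is known that if $(w,i)$ is an unreduced $\pi$-marked word there is a unique $j\neq i$ with $(w,j)$ a $\pi$-marked word. Define $\mathsf{push}(w,i)=(v,j)$ where $j=i$ if $w$ is reduced and $j$ is this unique index otherwise, and $v$ is $w$ with its $j$th letter increased by $1$. For a reduced word $w$, if there is an index $i$ (necessarily unique) with $(w,i)$ a $\pi$-marked word, let $N>0$ be minimal such that $\mathsf{push}^N(w,i)=(v,j)$ is reduced (such $N$ exists) and set $\mathfrak b_\pi(w)=v$; otherwise $\mathfrak b_\pi(w)=w$. It is known that $\mathfrak b_\pi$ preserves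 the descent set $\{i: w_i>w_{i+1}\}$ of reduced words. For $w=(w^1,\dots,w^n)\in\mathcal R_n(\sigma)$, $\mathfrak b_\pi(w)=(v^1,\dots,v^n)$ where $\ell(v^j)=\ell(w^j)$ and $v^1\cdots v^n=\mathfrak b_\pi(w^1\cdots w^n)$. *)

(* Defs.v *)
From HB Require Import structures.
From mathcomp Require Import all_boot all_order all_algebra.
From Stdlib Require Import ClassicalEpsilon.
Set Implicit Arguments. Unset Strict Implicit. Unset Printing Implicit Defensive.
Import Order.TTheory GRing.Theory Num.Theory.
Local Open Scope ring_scope.

Record SZ := mkSZ {
  sz_fun : int -> int;
  sz_bij : bijective sz_fun;
  sz_fin : exists a b : int, forall x : int, (x < a \/ b < x) -> sz_fun x = x }.

Definition s_tr (i : int) (x : int) : int :=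
  if x == i then i + 1 else if x == i + 1 then i else x.

Definition perm_of (w : seq int) : int -> int :=
  foldr (fun i f => s_tr i \o f) id w.

Definition reducedw (w : seq int) : Prop :=
  forall v : seq int, perm_of v =1 perm_of w -> (size w <= size v)%N.

Definition inR (sigma : int -> int) (w : seq int) : Prop :=
  reducedw w /\ perm_of w =1 sigma.

Definition del (i : nat) (w : seq int) : seq int := take i w ++ drop i.+1 w.

Definition marked (pi : SZ) (w : seq int) (i : nat) : Prop :=
  (i < size w)%N /\ inR (sz_fun pi) (del i w).

Definition push (pi : SZ) (p : seq int * nat) : seq int * nat :=
  let w := p.1 in let i := p.2 in
  let j := if excluded_middle_informative (reducedw w) then i
           else epsilon (inhabits 0%N) (fun j => j <> i /\ marked pi w j) in
  (set_nth 0 w j (nth 0 w j + 1), j).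

Definition bump (pi : SZ) (w : seq int) : seq int :=
  match excluded_middle_informative (exists i, marked pi w i) with
  | left _ =>
      let i := epsilon (inhabits 0%N) (marked pi w) in
      let N := epsilon (inhabits 0%N) (fun N =>
                 (0 < N)%N /\ reducedw (iter N (push pi) (w, i)).1 /\
                 forall M, (0 < M)%N -> (M < N)%N ->
                   ~ reducedw (iter M (push pi) (w, i)).1) in
      (iter N (push pi) (w, i)).1
  | right _ => w
  end.

Definition incr_word (a : seq int) : bool := sorted (fun x y : int => x < y) a.

(* element of the disjoint union over sigma of R_n(sigma); tuples are
   represented as lists of length n, components indexed 0..n-1 *)
Definition isFact (n : nat) (w : seq (seq int)) : Prop :=
  size w = n /\ all incr_word w /\ reducedw (flatten w).

Definition wt (w : seq (seq int)) : seq nat := map size w.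

Definition bfact (pi : SZ) (w : seq (seq int)) : seq (seq int) :=
  reshape (map size w) (bump pi (flatten w)).

(* pair(a,b): returns (unpaired letters of a, unpaired letters of b).
   foldr processes the letters of b from last (largest) to first. *)
Definition pair_step (y : int) (p : seq int * seq int) : seq int * seq int :=
  match [seq x <- p.1 | y < x] with
  | [::] => (p.1, y :: p.2)
  | x :: _ => (rem x p.1, p.2)
  end.
Definition unpaired (a b : seq int) : seq int * seq int :=
  foldr pair_step (a, [::]) b.

Definition next_up (x : int) (s : seq int) : int :=
  x + (find (fun k : nat => (x + k%:Z) \notin s) (iota 0 (size s).+1))%:Z.
Definition next_down (x : int) (s : seq int) : int :=
  x - (find (fun k : nat => (x - k%:Z) \notin s) (iota 0 (size s).+1))%:Z.

Definition insertw (y : int) (s : seq int) : seq int := sort <=%R (y :: s).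

Definition fop (i : nat) (w : seq (seq int)) : option (seq (seq int)) :=
  let a := nth [::] w i in let b := nth [::] w i.+1 in
  let ua := (unpaired a b).1 in
  if ua is [::] then None else
  let x := last 0 ua in
  Some (set_nth [::] (set_nth [::] w i (rem x a)) i.+1
                (insertw (next_up x b) b)).

Definition eop (i : nat) (w : seq (seq int)) : option (seq (seq int)) :=
  let a := nth [::] w i in let b := nth [::] w i.+1 in
  let ub := (unpaired a b).2 in
  if ub is [::] then None else
  let y := head 0 ub in
  Some (set_nth [::] (set_nth [::] w i (insertw (next_down y a) a)) i.+1
                (rem y b)).

Fixpoint iter_op (g : seq (seq int) -> option (seq (seq int))) (k : nat)
  (w : seq (seq int)) : option (seq (seq int)) :=
  match k with
  | 0%N => Some w
  | k'.+1 => if iter_op g k' w is Some v then g v else None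
  end.

Definition is_eps (i : nat) (w : seq (seq int)) (k : nat) : Prop :=
  iter_op (eop i) k w <> None /\ iter_op (eop i) k.+1 w = None.
Definition is_phi (i : nat) (w : seq (seq int)) (k : nat) : Prop :=
  iter_op (fop i) k w <> None /\ iter_op (fop i) k.+1 w = None.

(* Main.v *)
Require Import Defs.
From HB Require Import structures.
From mathcomp Require Import all_boot all_order all_algebra.
From mathcomp Require Import zify.
From Stdlib Require Import ClassicalEpsilon.
Set Implicit Arguments. Unset Strict Implicit. Unset Printing Implicit Defensive.
Import Order.TTheory GRing.Theory Num.Theory.
Local Open Scope ring_scope.

(* Read a word as a wiring diagram and record for each letter the pair of wires
   that it crosses. The word is reduced iff no pair crosses twice, and the
   indices [j] making [(w, j)] a marked word are those whose crossing equals the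
   crossing of one of them; there is one if [w] is reduced and there are two
   otherwise. Hence the push map is a bijection of marked words. The unmarked
   letters are bounded, so its orbits return to reduced words in both directions
   and the bump is a bijection. A simulation, letter by letter, shows that the
   bump commutes with each Coxeter-Knuth move at a given position, and it
   preserves descents.

   It then suffices to realise [f_i] by a sequence of Coxeter-Knuth moves that
   depends only on the lengths of the factors and on descents met on the way. For
   factors [a], [b] with a descent between them, row insertion of the first
   letter [b1] of [b] into [a] turns [a b1] into [y a'] by such moves; apply
   [f_i] recursively to [a'] and the rest of [b], and undo the row insertion.
   Negating and reversing words exchanges [e_i] and [f_i], which transfers the
   result to [e_i]. *)

(* [all_boot] has its own [bump] on ordinals. *)
Local Notation bump := Defs.bump.

(** * Crossings of reduced words *)

(** The obstacle is that a bump changes letters far apart, whereas [f_i] compares letters of two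
    factors, and these comparisons are not preserved. What survives is lengths, descents and the
    effect of Coxeter-Knuth moves, so the pairing has to be read off from these. Row insertion
    achieves this: taken first instead of last, which leaves the same letters of [a] unpaired, [b1]
    pairs with the very letter that its insertion puts out. Each insertion raises the number of
    unpaired letters of the first factor by one. Once no descent is left, all of them are unpaired,
    and [f_i] merely moves the break between the factors. The same recursion counts the unpaired
    letters, which decides when [f_i] is zero.

    In the simulation the two words can fall out of step, since one of them may pass through an
    extra unreduced word. The relation between them is therefore stated for marked words that need
    not be reduced, and the return times may differ.

    The orbits return because every push adds one to the sum of the letters, while this sum is
    bounded on unreduced marked words. *)

Ltac if_eq_cases := repeat match goal with
  |- context [if ?a == ?b then _ else _] =>
    lazymatch a with
    | context [if _ then _ else _] => fail
    | _ => case: (a =P b) => ?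
    end
  end.

Lemma s_trK (k : int) : involutive (s_tr k).
Proof. by move=> x; rewrite /s_tr; if_eq_cases; lia. Qed.

Lemma s_trC (k l x : int) : (k + 1 < l) || (l + 1 < k) ->
  s_tr k (s_tr l x) = s_tr l (s_tr k x).
Proof. by move=> h; rewrite /s_tr; if_eq_cases; lia. Qed.

Lemma s_tr_braid (k x : int) :
  s_tr k (s_tr (k + 1) (s_tr k x)) = s_tr (k + 1) (s_tr k (s_tr (k + 1) x)).
Proof. by rewrite /s_tr; if_eq_cases; lia. Qed.

Lemma perm_of_cat (u v : seq int) (x : int) :
  perm_of (u ++ v) x = perm_of u (perm_of v x).
Proof. by elim: u x => //= k u IH x; rewrite IH. Qed.

Lemma perm_of_ctx (A C l1 l2 : seq int) : perm_of l1 =1 perm_of l2 ->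
  perm_of (A ++ l1 ++ C) =1 perm_of (A ++ l2 ++ C).
Proof. by move=> h x; rewrite !perm_of_cat h. Qed.

Lemma perm_of_revK (u : seq int) : cancel (perm_of u) (perm_of (rev u)).
Proof.
elim: u => //= k u IH x; rewrite rev_cons -cats1 perm_of_cat /= s_trK; exact: IH.
Qed.

Lemma perm_of_Krev (u : seq int) : cancel (perm_of (rev u)) (perm_of u).
Proof. by move=> x; rewrite -{1}[u]revK perm_of_revK. Qed.

Lemma perm_of_inj (u : seq int) : injective (perm_of u).
Proof. exact: can_inj (perm_of_revK u). Qed.

Definition tr (c : int * int) (x : int) : int :=
  if x == c.1 then c.2 else if x == c.2 then c.1 else x.

Definition upair (x y : int) : int * int := if x < y then (x, y) else (y, x).

Lemma upair_lt x y : x <> y -> (upair x y).1 < (upair x y).2.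
Proof. by rewrite /upair; case: (ltP x y) => h /= ?; lia. Qed.

Lemma tr_inj c c' : c.1 < c.2 -> c'.1 < c'.2 -> tr c =1 tr c' -> c = c'.
Proof.
case: c c' => [a b] [a' b'] /= h h' e.
have := e a; have := e b; rewrite /tr /=; do !case: eqP => ?; move=> *;
  congr pair; lia.
Qed.

(** Wires are named by their positions at the right end of the word. A letter [k] before the suffix
    [v] swaps the positions [k] and [k + 1], which hold the wires with these images under [v];
    [rev v] computes the inverse of [v]. The pair is sorted, so that equality of crossings ignores
    the order. *)
Fixpoint cross (w : seq int) : seq (int * int) :=
  if w is k :: v then
    upair (perm_of (rev v) k) (perm_of (rev v) (k + 1)) :: cross v
  else [::].

Lemma size_cross w : size (cross w) = size w.
Proof. by elim: w => //= k v ->. Qed.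

Lemma cross_lt w c : c \in cross w -> c.1 < c.2.
Proof.
elim: w => //= k v IH; rewrite inE => /orP [/eqP -> | /IH //].
by apply: upair_lt => /perm_of_inj; lia.
Qed.

(** Conjugating [s_tr k] by [v] gives the transposition of the two wires that meet at the letter
    [k]. *)
Lemma tr_cross v k x :
  perm_of v (tr (upair (perm_of (rev v) k) (perm_of (rev v) (k + 1))) x)
  = s_tr k (perm_of v x).
Proof.
set a := perm_of _ k; set b := perm_of _ (k + 1).
have ea : perm_of v a = k by rewrite perm_of_Krev.
have eb : perm_of v b = k + 1 by rewrite perm_of_Krev.
have -> : tr (upair a b) x = tr (a, b) x.
  by rewrite /upair; case: ltP => // _; rewrite /tr /=; if_eq_cases; lia.
rewrite /tr /=; case: eqP => [->|na]; first by rewrite ea eb /s_tr eqxx.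
case: eqP => [->|nb]; first by rewrite ea eb /s_tr eqxx; case: eqP; lia.
rewrite /s_tr; case: eqP => [e|_].
  by case: na; apply: (@perm_of_inj v); rewrite ea.
by case: eqP => // e; case: nb; apply: (@perm_of_inj v); rewrite eb.
Qed.

Lemma perm_of_del w i x : (i < size w)%N ->
  perm_of (del i w) x = perm_of w (tr (nth (0, 0) (cross w) i) x).
Proof.
elim: w i x => [|k v IH] [|i] x //= hi; last by rewrite -IH.
by rewrite /del /= drop0 tr_cross s_trK.
Qed.

Lemma s_tr_lt k (p q : int) : p <> q ->
  (s_tr k q < s_tr k p) =
  (((p == k) && (q == k + 1)) || ((p == k + 1) && (q == k))) (+) (q < p).
Proof. by move=> ?; rewrite /s_tr; if_eq_cases; lia. Qed.

(* Each crossing of the wires [a] and [b] reverses their relative order. *)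
Lemma inversion_odd w (a b : int) : a < b ->
  (perm_of w b < perm_of w a) = odd (count_mem (a, b) (cross w)).
Proof.
move=> ab; elim: w => [|k v IH] /=; first by lia.
set c := upair _ _; rewrite oddD -IH.
have hv z l : (perm_of v z == l) = (perm_of (rev v) l == z).
  by apply/eqP/eqP => <-; rewrite ?perm_of_revK ?perm_of_Krev.
have hab := @perm_of_inj v a b.
have -> : (c == (a, b)) = ((perm_of v a == k) && (perm_of v b == k + 1)) ||
                         ((perm_of v a == k + 1) && (perm_of v b == k)).
  rewrite !hv /c {hv hab IH} /upair.
  by case: (ltP (perm_of (rev v) k)) => h; rewrite xpair_eqE; lia.
have : perm_of v a <> perm_of v b by move=> /hab; lia.
by rewrite oddb => ?; exact: s_tr_lt.
Qed.

Lemma uniq_cross_inv w (a b : int) : a < b -> uniq (cross w) ->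
  (perm_of w b < perm_of w a) = ((a, b) \in cross w).
Proof. by move=> ab u; rewrite inversion_odd // count_uniq_mem //; case: (_ \in _). Qed.

Lemma inv_cross w (a b : int) : a < b -> perm_of w b < perm_of w a ->
  (a, b) \in cross w.
Proof.
move=> ab; rewrite inversion_odd // -has_pred1 has_count.
by case: count.
Qed.

Lemma reduced_factor A B C : reducedw (A ++ B ++ C) -> reducedw B.
Proof.
move=> h v e; have /= := h (A ++ v ++ C) (perm_of_ctx A C e).
by rewrite !size_cat; lia.
Qed.

Lemma reduced_eq w w' : reducedw w -> perm_of w' =1 perm_of w ->
  size w' = size w -> reducedw w'.
Proof. by move=> h e s v ev; rewrite s; apply: h => x; rewrite ev e. Qed.

Lemma size_del i w : (i < size w)%N -> size (del i w) = (size w).-1.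
Proof. by move=> h; rewrite /del size_cat size_takel ?size_drop; lia. Qed.

(** If the crossing of the first letter recurs, deleting both letters leaves the permutation
    unchanged and shortens the word by two. *)
Lemma reduced_uniq_cross w : reducedw w -> uniq (cross w).
Proof.
elim: w => //= k v IH h.
rewrite IH ?andbT; last by apply: (@reduced_factor [:: k] v [::]); rewrite cats0.
apply/negP => /(nthP (0, 0)) [j]; rewrite size_cross => hj ej.
have := h (del j v); rewrite size_del //= => H.
suff : ((size v).+1 <= (size v).-1)%N by lia.
by apply: H => x; rewrite perm_of_del // ej tr_cross.
Qed.

(** * Marked words and the push map *)

Lemma nth_cross_lt w i : (i < size w)%N ->
  (nth (0, 0) (cross w) i).1 < (nth (0, 0) (cross w) i).2.
Proof. by move=> h; apply: (@cross_lt w); rewrite mem_nth ?size_cross. Qed.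

Lemma marked_perm pi w i j : marked pi w i -> (j < size w)%N ->
  perm_of (del j w) =1 perm_of (del i w) -> marked pi w j.
Proof.
move=> [hi [r e]] hj ed; split=> //; split; last by move=> x; rewrite ed.
by apply: reduced_eq r ed _; rewrite !size_del.
Qed.

(** Deletion multiplies the fixed permutation of [w] by a transposition, and a transposition
    determines its pair of wires. *)
Lemma marked_crossE pi w i j : marked pi w i ->
  marked pi w j <-> (j < size w)%N /\ nth (0, 0) (cross w) j = nth (0, 0) (cross w) i.
Proof.
move=> m; have [hi [r e]] := m; split=> [[hj [_ e']]|[hj ec]].
  split=> //; apply: tr_inj; try exact: nth_cross_lt.
  move=> x; apply: (@perm_of_inj w).
  by rewrite -!perm_of_del // e e'.
by apply: (marked_perm m hj) => x; rewrite !perm_of_del // ec.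
Qed.

Lemma marked_uniq pi w i j : reducedw w -> marked pi w i -> marked pi w j -> i = j.
Proof.
move=> /reduced_uniq_cross u mi /(marked_crossE _ mi) [hj /eqP].
by rewrite nth_uniq ?size_cross //; [move/eqP | case: mi].
Qed.

Lemma cross_cat u v : drop (size u) (cross (u ++ v)) = cross v.
Proof. by elim: u => /= [|k u IH]; rewrite ?drop0. Qed.

(* Deleting the leftmost of three equal crossings leaves the other two, which
   lie in the suffix, unchanged. *)
Lemma marked_lt3 pi w i j l : marked pi w i -> marked pi w j -> marked pi w l ->
  (i < j)%N -> (j < l)%N -> False.
Proof.
move=> mi /(marked_crossE _ mi) [hj ej] /(marked_crossE _ mi) [hl el] ij jl.
have [hi [/reduced_uniq_cross u _]] := mi.
have {}u : uniq (cross (drop i.+1 w)).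
  by rewrite -(cross_cat (take i w)); exact: drop_uniq.
have ec : cross (drop i.+1 w) = drop i.+1 (cross w).
  by rewrite -(cross_cat (take i.+1 w)) cat_take_drop size_takel.
move: u; rewrite ec => u.
have : nth (0, 0) (drop i.+1 (cross w)) (j - i.+1) =
       nth (0, 0) (drop i.+1 (cross w)) (l - i.+1).
  by rewrite !nth_drop !subnKC ?ej ?el //; lia.
by move/eqP; rewrite nth_uniq ?size_drop ?size_cross //; lia.
Qed.

Lemma marked_le2 pi w i j l : marked pi w i -> marked pi w j -> marked pi w l ->
  j <> i -> l <> i -> j = l.
Proof.
move=> mi mj ml ji li.
have H a b c (ma : marked pi w a) (mb : marked pi w b) (mc : marked pi w c) :
    (a < b)%N -> (b < c)%N -> False by exact: marked_lt3 ma mb mc.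
have := H _ _ _ mi mj ml; have := H _ _ _ mi ml mj; have := H _ _ _ mj mi ml.
have := H _ _ _ ml mi mj; have := H _ _ _ mj ml mi; have := H _ _ _ ml mj mi.
lia.
Qed.

(** A parity argument: the wires of the marked crossing are not inverted by [w], so they cross an
    even number of times. They cross at least once, at [i], hence a second time. *)
Lemma marked_other pi w i : marked pi w i -> ~ reducedw w ->
  exists j, j <> i /\ marked pi w j.
Proof.
move=> m nr; have [hi [r e]] := m.
pose c := nth (0, 0) (cross w) i.
have hc : c.1 < c.2 by exact: nth_cross_lt.
have [u [eu su]] : exists u, perm_of u =1 perm_of w /\ (size u < size w)%N.
  case: (classic (exists u, perm_of u =1 perm_of w /\ (size u < size w)%N)) => // n.
  case: nr => v ev; rewrite leqNgt; apply/negP => h; by case: n; exists v.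
(* An inversion would force the shorter word [u] to contain the crossing [c]; deleting it there
   would give a word for [pi] shorter than the reduced word [del i w]. *)
have ninv : ~~ (perm_of w c.2 < perm_of w c.1).
  apply/negP; rewrite -!eu => /(inv_cross hc) /(nthP (0, 0)) [j].
  rewrite size_cross => hj ej.
  have := r (del j u); rewrite !size_del // => H.
  suff : ((size w).-1 <= (size u).-1)%N by lia.
  by apply: H => x; rewrite !perm_of_del // ej eu -surjective_pairing.
move: ninv; rewrite inversion_odd // -surjective_pairing => ev.
have hi' : (i < size (cross w))%N by rewrite size_cross.
have : (1 < count_mem c (cross w))%N.
  have : c \in cross w by apply: mem_nth; rewrite size_cross.
  by rewrite -has_pred1 has_count; case: count ev => // -[].
have e1 : count_mem c [:: c] = 1%N by rewrite /= eqxx.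
rewrite -(cat_take_drop i (cross w)) (drop_nth (0, 0) hi') -/c count_cat -cat1s.
rewrite count_cat e1 addnCA add1n ltnS.
rewrite addn_gt0 -!has_count !has_pred1 => /orP [] /(nthP (0, 0)) [j].
  rewrite (size_takel (ltnW hi')) => hj; rewrite nth_take // => ej.
  exists j; split; first lia.
  by apply/(marked_crossE _ m); rewrite ej; split=> //; lia.
rewrite size_drop size_cross => hj; rewrite nth_drop => ej.
exists (i.+1 + j)%N; split; first lia.
by apply/(marked_crossE _ m); rewrite ej; split=> //; lia.
Qed.

Lemma marked_unreduced pi w i j : marked pi w i -> marked pi w j -> j <> i ->
  ~ reducedw w.
Proof. by move=> mi mj ji r; apply: ji; apply: marked_uniq r mj mi. Qed.

(** The increment is a parameter so that [-1] inverts the step of [push]. *)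
Definition shift (d : int) (j : nat) (w : seq int) : seq int :=
  set_nth 0 w j (@nth int 0 w j + d).

Lemma shift_cat d A x C : shift d (size A) (A ++ x :: C) = A ++ (x + d) :: C.
Proof.
rewrite /shift nth_cat ltnn subnn /=; elim: A => //= a A ->; by [].
Qed.

Lemma split_nth (w : seq int) j : (j < size w)%N ->
  w = take j w ++ nth 0 w j :: drop j.+1 w.
Proof. by move=> h; rewrite -drop_nth // cat_take_drop. Qed.

Lemma size_shift d j w : (j < size w)%N -> size (shift d j w) = size w.
Proof. by move=> h; rewrite size_set_nth; apply/maxn_idPr. Qed.

Lemma nth_shift d j w i :
  @nth int 0 (shift d j w) i = @nth int 0 w i + (if i == j then d else 0).
Proof.
rewrite nth_set_nth /=; case: eqP => [->|] //; by rewrite addr0.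
Qed.

Lemma shiftK d j w : (j < size w)%N -> shift (- d) j (shift d j w) = w.
Proof.
move=> h; apply: (@eq_from_nth _ 0); rewrite !size_shift ?size_shift // => i _.
by rewrite !nth_shift; case: eqP => _; rewrite ?addr0 // addrK.
Qed.

Lemma del_shift d j w : (j < size w)%N -> del j (shift d j w) = del j w.
Proof.
move=> h; have e : size (take j w) = j by rewrite size_takel 1?ltnW.
rewrite {1}(split_nth h) -{2}e shift_cat /del take_cat drop_cat e ltnn subnn take0.
by rewrite cats0 ltnNge leqnSn /= subSnn /= drop0.
Qed.

Lemma marked_shift pi d w j : marked pi w j -> marked pi (shift d j w) j.
Proof. by move=> [h m]; split; rewrite ?size_shift // del_shift. Qed.

Lemma push_reduced pi w i : reducedw w -> push pi (w, i) = (shift 1 i w, i).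
Proof. by move=> r; rewrite /push /=; case: excluded_middle_informative => [?|//]. Qed.

Lemma push_unreduced pi w i j : marked pi w i -> marked pi w j -> j <> i ->
  push pi (w, i) = (shift 1 j w, j).
Proof.
move=> mi mj ji; have nr := marked_unreduced mi mj ji.
rewrite /push /=; case: excluded_middle_informative => [//|n /=].
have [h1 h2] := epsilon_spec (inhabits 0%N) (fun j => j <> i /\ marked pi w j)
  (ex_intro _ j (conj ji mj)).
by rewrite -(marked_le2 mi mj h2 ji h1).
Qed.

Lemma pushE pi w i : marked pi w i ->
  exists j, [/\ push pi (w, i) = (shift 1 j w, j), marked pi w j &
    (reducedw w /\ j = i) \/ (~ reducedw w /\ j <> i)].
Proof.
move=> m; case: (classic (reducedw w)) => r.
  by exists i; split=> //; [exact: push_reduced | left].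
have [j [ji mj]] := marked_other m r.
by exists j; split=> //; [exact: push_unreduced | right].
Qed.

Lemma marked_push pi s : marked pi s.1 s.2 ->
  marked pi (push pi s).1 (push pi s).2.
Proof. by case: s => w i /pushE [j [-> m _]]; exact: marked_shift. Qed.

Lemma marked_iter_push pi N s : marked pi s.1 s.2 ->
  marked pi (iter N (push pi) s).1 (iter N (push pi) s).2.
Proof. by move=> m; elim: N => //= N; exact: marked_push. Qed.

(** The resulting index says which letter was raised, so lowering it recovers the word. The old mark
    is this same index if that word is reduced and the other marked index if not. *)
Lemma push_inj pi s s' : marked pi s.1 s.2 -> marked pi s'.1 s'.2 ->
  push pi s = push pi s' -> s = s'.
Proof.
case: s s' => [w i] [w' i'] /= m m'.
have [j [-> mj c]] := pushE m; have [j' [-> mj' c']] := pushE m' => -[e ej].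
subst j'.
have ew : w = w'.
  by rewrite -(@shiftK 1 j w) ?e ?shiftK //; [case: mj' | case: mj].
subst w'; congr pair; case: c c' => [[r1 e1]|[r1 e1]] [[r2 e2]|[r2 e2]] //.
  by rewrite -e1.
by apply: (marked_le2 mj m m'); auto.
Qed.

Lemma push_surj pi s : marked pi s.1 s.2 ->
  exists s', marked pi s'.1 s'.2 /\ push pi s' = s.
Proof.
case: s => v j /= m; have hj : (j < size v)%N by case: m.
have ev : shift 1 j (shift (-1) j v) = v by rewrite -[X in shift X]opprK shiftK.
have mw := marked_shift (-1) m; set w := shift (-1) j v in mw ev *.
case: (classic (reducedw w)) => r.
  by exists (w, j); rewrite push_reduced // ev.
have [i [ij mi]] := marked_other mw r.
exists (w, i); split=> //=; rewrite (push_unreduced mi mw) ?ev //.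
by move=> e; apply: ij.
Qed.

(** * The sum of the letters along a push orbit *)

Definition total (w : seq int) : int := \sum_(x <- w) x.

Lemma total_shift d j w : (j < size w)%N -> total (shift d j w) = total w + d.
Proof.
move=> h; have e : size (take j w) = j by rewrite size_takel 1?ltnW.
rewrite {1}(split_nth h) -{1}e shift_cat [in RHS](split_nth h).
rewrite /total !big_cat !big_cons /=; lia.
Qed.

Lemma total_push pi s : marked pi s.1 s.2 ->
  total (push pi s).1 = total s.1 + 1.
Proof. by case: s => w i /pushE [j [-> [h _] _]]; rewrite total_shift. Qed.

Lemma size_push pi s : marked pi s.1 s.2 -> size (push pi s).1 = size s.1.
Proof. by case: s => w i /pushE [j [-> [h _] _]]; rewrite size_shift. Qed.

Lemma size_iter_push pi N s : marked pi s.1 s.2 ->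
  size (iter N (push pi) s).1 = size s.1.
Proof.
by move=> m; elim: N => //= N <-; rewrite size_push //; exact: marked_iter_push.
Qed.

Lemma total_bounds (w : seq int) (lo hi : int) :
  (forall x, x \in w -> lo <= x <= hi) ->
  lo * (size w)%:Z <= total w <= hi * (size w)%:Z.
Proof.
rewrite /total; elim: w => [|x w IH] h; first by rewrite big_nil !mulr0 lexx.
rewrite big_cons /=; have hx := h x (mem_head _ _).
have hw : lo * (size w)%:Z <= \sum_(y <- w) y <= hi * (size w)%:Z.
  by apply: IH => y hy; apply: h; rewrite inE hy orbT.
rewrite !intS !mulrDr !mulr1.
by case/andP: hx => h1 h2; case/andP: hw => h3 h4; rewrite !lerD.
Qed.

(** Only the generator [s_tr k] moves a point across the gap between [k] and [k + 1]. *)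
Lemma perm_of_half k w x : k \notin w -> (perm_of w x <= k) = (x <= k).
Proof.
elim: w => //= l w IH; rewrite inE negb_or => /andP [kl /IH <-].
by rewrite /s_tr; if_eq_cases; lia.
Qed.

Lemma letter_inversion w k : reducedw w -> k \in w ->
  exists x y : int, x <= k < y /\ perm_of w y < perm_of w x.
Proof.
move=> r kw; pose v := rev w; have kv : k \in v by rewrite mem_rev.
(* The first occurrence of [k] in the reversed word is its last one in [w], so the suffix [rev p1]
   avoids [k] and keeps the wires of this crossing on their sides of the gap. *)
pose p1 := take (index k v) v; pose p2 := drop (index k v).+1 v.
have e : v = p1 ++ k :: p2.
  by rewrite -{1}(cat_take_drop (index k v) v) (drop_nth 0) ?index_mem // nth_index.
have nk : k \notin p1 by apply/negP => /index_ltn; rewrite ltnn.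
have ew : w = rev p2 ++ k :: rev p1 by rewrite -[w]revK -/v e rev_cat rev_cons cat_rcons.
have nk' : k \notin rev (rev p1) by rewrite revK.
set x := perm_of (rev (rev p1)) k; set y := perm_of (rev (rev p1)) (k + 1).
have hx : x <= k by rewrite perm_of_half.
have hy : ~~ (y <= k) by rewrite perm_of_half //; lia.
exists x, y; split; first lia.
have xy : x < y by lia.
rewrite (uniq_cross_inv xy (reduced_uniq_cross r)) ew.
have h : (x, y) \in drop (size (rev p2)) (cross (rev p2 ++ k :: rev p1)).
  by rewrite cross_cat /= -/x -/y /upair xy inE eqxx.
exact: mem_drop h.
Qed.

(** Every letter is straddled by an inversion of [pi]. For a letter outside the support one of the
    two points would be fixed, and then the inversion would force the other to be fixed as well,
    which is absurd. *)
Lemma letters_bounded (pi : SZ) : exists lo hi : int,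
  forall w, inR (sz_fun pi) w -> forall x, x \in w -> lo <= x <= hi.
Proof.
have [a [b hab]] := sz_fin pi; exists (a - 1), b => w [r e] k kw.
have [x [y [hk]]] := letter_inversion r kw; rewrite !e => hxy.
have inj := bij_inj (sz_bij pi).
have fx z : (z < a) || (b < z) -> sz_fun pi z = z by move=> h; apply: hab; lia.
have fx' z : (sz_fun pi z < a) || (b < sz_fun pi z) -> sz_fun pi z = z.
  by move=> h; apply: inj; apply: fx.
have := fx x; have := fx y; have := fx' x; have := fx' y; lia.
Qed.

(** There are two marked indices, so each letter survives in at least one of the two deletions and
    is a letter of a reduced word of [pi]. *)
Lemma unreduced_total_bounded (pi : SZ) : exists lo hi : int,
  forall w i, marked pi w i -> ~ reducedw w ->
    lo * (size w)%:Z <= total w <= hi * (size w)%:Z.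
Proof.
have [lo [hi h]] := letters_bounded pi; exists lo, hi => w i m nr.
have [j [ji mj]] := marked_other m nr; have [hi' ri] := m; have [hj rj] := mj.
apply: total_bounds => x /(nthP 0) [k hk ek].
have H l : k <> l -> (l < size w)%N -> x \in del l w.
  move=> kl hl; rewrite /del mem_cat -ek; case: (ltnP k l) => hkl.
    apply/orP; left; apply/(nthP 0); exists k; rewrite ?nth_take //.
    by rewrite size_takel // ltnW.
  apply/orP; right; apply/(nthP 0); exists (k - l.+1)%N; rewrite ?size_drop; first lia.
  by rewrite nth_drop subnKC //; lia.
case: (k =P i) => ki; first by apply: h rj _ _; apply: H => // ?; apply: ji; congruence.
by apply: h ri _ _; exact: H.
Qed.

(** * First returns and bijectivity of the bump *)

(** Convertible to the predicate under the [epsilon] in [bump], so that [epsilon_spec] applies to it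
    directly. *)
Definition first_return (pi : SZ) (s : seq int * nat) (N : nat) : Prop :=
  (0 < N)%N /\ reducedw (iter N (push pi) s).1 /\
  forall M, (0 < M)%N -> (M < N)%N -> ~ reducedw (iter M (push pi) s).1.

Lemma first_return1 pi s : reducedw (push pi s).1 -> first_return pi s 1.
Proof. by move=> r; split=> //; split=> // M; lia. Qed.

Lemma first_returnS pi s N : ~ reducedw (push pi s).1 ->
  first_return pi (push pi s) N -> first_return pi s N.+1.
Proof.
move=> nr [N0 [rN H]]; split=> //; split; first by rewrite iterSr.
by case=> [|[|M]] // _ hM; rewrite iterSr; apply: H; lia.
Qed.

Lemma first_return_uniq pi s N M : first_return pi s N -> first_return pi s M -> N = M.
Proof.
move=> [N0 [rN HN]] [M0 [rM HM]]; case: (ltngtP N M) => // h.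
  by case: (HM _ N0 h).
by case: (HN _ M0 h).
Qed.

(** The induction is on the distance [m] of the sum of the letters from its upper bound: each push
    to an unreduced word uses up one unit. *)
Lemma first_return_ex pi s : marked pi s.1 s.2 -> exists N, first_return pi s N.
Proof.
have [lo [hi hb]] := unreduced_total_bounded pi.
suff H (m : nat) t : marked pi t.1 t.2 ->
    hi * (size t.1)%:Z - total t.1 < m%:Z -> exists N, first_return pi t N.
  pose z := hi * (size s.1)%:Z - total s.1.
  by move=> ms; apply: (H (absz z).+1 s ms); rewrite -/z; lia.
elim: m t => [|m IH] t mt ht; case: (classic (reducedw (push pi t).1)) => r;
  try by exists 1%N; exact: first_return1.
all: have := hb _ _ (marked_push mt) r; rewrite total_push // size_push // => hp.
  lia.
have [|N hN] := IH _ (marked_push mt); first by rewrite total_push // size_push //; lia.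
by exists N.+1; exact: first_returnS.
Qed.

(** Going backwards along [push_surj] lowers the sum by one each time; the lower bound on unreduced
    words stops the descent at a reduced one. *)
Lemma first_return_onto pi s : marked pi s.1 s.2 -> reducedw s.1 ->
  exists t N, [/\ marked pi t.1 t.2, reducedw t.1, first_return pi t N
    & iter N (push pi) t = s].
Proof.
have [lo [hi hb]] := unreduced_total_bounded pi.
suff H (m : nat) u : marked pi u.1 u.2 -> total u.1 - lo * (size u.1)%:Z < m%:Z ->
    exists t N, [/\ marked pi t.1 t.2, reducedw t.1, (0 < N)%N,
      iter N (push pi) t = u &
      forall M, (0 < M)%N -> (M < N)%N -> ~ reducedw (iter M (push pi) t).1].
  move=> ms rs; pose z := total s.1 - lo * (size s.1)%:Z.
  have [] := H (absz z).+1 s ms; first by rewrite -/z; lia.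
  by move=> t [N [mt rt N0 e HN]]; exists t, N; split=> //; split=> //; rewrite e.
elim: m u => [|m IH] u mu hu; have [t [mt et]] := push_surj mu;
  (case: (classic (reducedw t.1)) => r; first by exists t, 1%N; split=> // M; lia).
all: have := hb _ _ mt r; have := total_push mt; have := size_push mt; rewrite et => e1 e2 e3.
  move: hu e3; rewrite e1 e2; lia.
have [|v [N [mv rv N0 ev HN]]] := IH _ mt; first by move: hu; rewrite e1 e2; lia.
exists v, N.+1; split=> //=; first by rewrite ev.
move=> M M0; rewrite ltnS leq_eqVlt => /orP [/eqP ->|]; first by rewrite ev.
exact: HN.
Qed.

Lemma bump_marked pi w i N : reducedw w -> marked pi w i -> first_return pi (w, i) N ->
  bump pi w = (iter N (push pi) (w, i)).1.
Proof.
move=> r m h; rewrite /bump; case: excluded_middle_informative; last by case; exists i.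
move=> ex; set i' := epsilon _ (marked pi w).
have -> : i' = i by apply: (marked_uniq r _ m); exact: epsilon_spec.
have h' := epsilon_spec (inhabits 0%N) (first_return pi (w, i)) (ex_intro _ N h).
by rewrite (first_return_uniq h h').
Qed.

Lemma bump_unmarked pi w : ~ (exists i, marked pi w i) -> bump pi w = w.
Proof. by rewrite /bump; case: excluded_middle_informative. Qed.

Lemma bump_spec pi w i : reducedw w -> marked pi w i ->
  exists N j, [/\ first_return pi (w, i) N, iter N (push pi) (w, i) = (bump pi w, j),
    marked pi (bump pi w) j & reducedw (bump pi w)].
Proof.
move=> r m; have [N h] := @first_return_ex pi (w, i) m.
exists N, (iter N (push pi) (w, i)).2; rewrite (bump_marked r m h); split=> //.
- exact: surjective_pairing.
- exact: marked_iter_push.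
by case: h => _ [].
Qed.

Lemma bump_reduced pi w : reducedw w -> reducedw (bump pi w).
Proof.
move=> r; case: (classic (exists i, marked pi w i)) => [[i m]|n].
  by have [N [j []]] := bump_spec r m.
by rewrite bump_unmarked.
Qed.

Lemma size_bump pi w : reducedw w -> size (bump pi w) = size w.
Proof.
move=> r; case: (classic (exists i, marked pi w i)) => [[i m]|n].
  have [N [j [_ e _ _]]] := bump_spec r m.
  by rewrite -[w in RHS]/(w, i).1 -(size_iter_push N (s := (w, i)) m) e.
by rewrite bump_unmarked.
Qed.

Lemma bump_inj pi w w' : reducedw w -> reducedw w' -> bump pi w = bump pi w' -> w = w'.
Proof.
move=> r r'.
case: (classic (exists i, marked pi w i)) => [[i m]|n];
case: (classic (exists i, marked pi w' i)) => [[i' m']|n'].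
- have [N [j [[N0 [_ H]] e mj rj]]] := bump_spec r m.
  have [N' [j' [[N0' [_ H']] e' mj' rj']]] := bump_spec r' m' => eb.
  move: e' mj'; rewrite -eb => e' /(marked_uniq rj mj) ej; subst j'.
  (* Both orbits end in the same marked word. Cancelling the last [A] pushes puts the reduced word
     [u] on the orbit of [u'] before its first return, so it can only be its starting point. *)
  have main A B u u' : (forall M, (0 < M)%N -> (M < B)%N -> ~ reducedw (iter M (push pi) u').1) ->
      (A <= B)%N -> (0 < A)%N -> marked pi u.1 u.2 -> marked pi u'.1 u'.2 -> reducedw u.1 ->
      iter A (push pi) u = iter B (push pi) u' -> u = u'.
    move=> HB AB A0 mu mu' ru.
    have -> : B = (A + (B - A))%N by lia.
    rewrite iterD => eAB.
    have eu : u = iter (B - A) (push pi) u'.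
      elim: A {HB AB A0} (B - A)%N eAB => //= A IH k /push_inj E; apply: IH.
      by apply: E; apply: marked_iter_push => //; exact: marked_iter_push.
    case: (posnP (B - A)) eu => [-> //|k0 eu].
    by case: (HB (B - A)%N) => //; [lia | rewrite -eu].
  have E : iter N (push pi) (w, i) = iter N' (push pi) (w', i') by rewrite e e'.
  case: (leqP N N') => h.
    by case: (main N N' (w, i) (w', i') H' h N0 m m' r E).
  by case: (main N' N (w', i') (w, i) H (ltnW h) N0' m' m r' (esym E)).
- have [N [j [_ e mj rj]]] := bump_spec r m.
  by rewrite [bump pi w']bump_unmarked // => eb; case: n'; exists j; rewrite -eb.
- have [N [j [_ e mj rj]]] := bump_spec r' m'.
  by rewrite [bump pi w]bump_unmarked // => eb; case: n; exists j; rewrite eb.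
- by rewrite !bump_unmarked.
Qed.

Lemma bump_surj pi v : reducedw v -> exists w, reducedw w /\ bump pi w = v.
Proof.
move=> r; case: (classic (exists i, marked pi v i)) => [[i m]|n]; last first.
  by exists v; rewrite bump_unmarked.
have [[w j] [N [/= mt rt h e]]] := @first_return_onto pi (v, i) m r.
by exists w; split=> //; rewrite (bump_marked rt mt h) e.
Qed.

(** * Descents and Coxeter-Knuth moves *)

Lemma del_catl j A B : (j < size A)%N -> del j (A ++ B) = del j A ++ B.
Proof.
move=> h; rewrite /del take_cat drop_cat h -catA; case: ltnP => // h'.
have -> : j.+1 = size A by lia.
by rewrite subnn drop0 drop_size.
Qed.

Lemma del_catr k A B : del (size A + k) (A ++ B) = A ++ del k B.
Proof.
rewrite /del take_cat drop_cat; have -> : (size A + k < size A)%N = false by lia.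
have -> : ((size A + k).+1 < size A)%N = false by lia.
have -> : ((size A + k).+1 - size A = k.+1)%N by lia.
by rewrite catA addKn.
Qed.

Lemma shift_catl d j A B : (j < size A)%N -> shift d j (A ++ B) = shift d j A ++ B.
Proof.
move=> h; rewrite {1}(split_nth h) [in RHS](split_nth h) -catA /=.
have e : size (take j A) = j by rewrite size_takel // ltnW.
by rewrite -{1}e shift_cat -[X in shift d X (take _ _ ++ _)]e shift_cat -catA.
Qed.

Lemma shift_catr d k A B : shift d (size A + k) (A ++ B) = A ++ shift d k B.
Proof. by elim: A => //= a A IH; congr cons. Qed.

Lemma reduced_adj_neq w p : reducedw w -> (p.+1 < size w)%N ->
  nth 0 w p <> nth 0 w p.+1.
Proof.
move=> r hp e.
have ew : w = take p w ++ [:: nth 0 w p; nth 0 w p.+1] ++ drop p.+2 w.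
  by rewrite /= -!drop_nth ?cat_take_drop //; lia.
move: r; rewrite ew => /reduced_factor r.
suff : (2 <= 0)%N by [].
by apply: (r [::]) => x; rewrite e /= s_trK.
Qed.

Lemma marked_eq_next pi w p : (p.+1 < size w)%N -> nth 0 w p = nth 0 w p.+1 ->
  marked pi w p <-> marked pi w p.+1.
Proof.
move=> hp e.
have ed : del p w = del p.+1 w.
  rewrite /del (drop_nth 0 hp) (take_nth 0) 1?ltnW // e cat_rcons //.
by rewrite /marked ed hp (ltnW hp).
Qed.

(** Raising the left letter can turn an ascent into an equality, with the mark on that letter. Equal
    neighbours have equal deletions, so the next push raises the right letter and restores the
    ascent. *)
Definition weak_ascent p (s : seq int * nat) : Prop :=
  nth 0 s.1 p < nth 0 s.1 p.+1 \/ (nth 0 s.1 p = nth 0 s.1 p.+1 /\ s.2 = p).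

Definition weak_descent p (s : seq int * nat) : Prop :=
  nth 0 s.1 p.+1 < nth 0 s.1 p \/ (nth 0 s.1 p = nth 0 s.1 p.+1 /\ s.2 = p.+1).

Lemma weak_ascent_push pi p s : marked pi s.1 s.2 -> (p.+1 < size s.1)%N ->
  weak_ascent p s -> weak_ascent p (push pi s).
Proof.
case: s => w i m hp; have [j [-> mj c]] := pushE m.
rewrite /weak_ascent /= !nth_shift => -[h|[e ei]].
  by case: (p =P j) => h1; case: (p.+1 =P j) => h2; lia.
have j1 : j = p.+1.
  subst i; case: c => [[r _]|[_ jp]]; first by case: (reduced_adj_neq r hp e).
  by apply: (marked_le2 m mj _ jp); [apply/(marked_eq_next pi hp e) | move=> /= ?; lia].
by left; case: (p =P j) => h1; case: (p.+1 =P j) => h2; lia.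
Qed.

Lemma weak_descent_push pi p s : marked pi s.1 s.2 -> (p.+1 < size s.1)%N ->
  weak_descent p s -> weak_descent p (push pi s).
Proof.
case: s => w i m hp; have [j [-> mj c]] := pushE m.
rewrite /weak_descent /= !nth_shift => -[h|[e ei]].
  by case: (p =P j) => h1; case: (p.+1 =P j) => h2; lia.
have j1 : j = p.
  subst i; case: c => [[r _]|[_ jp]]; first by case: (reduced_adj_neq r hp e).
  by apply: (marked_le2 m mj _ jp); [apply/(marked_eq_next pi hp e) | move=> /= ?; lia].
by left; case: (p =P j) => h1; case: (p.+1 =P j) => h2; lia.
Qed.

Lemma bump_descent pi w p : reducedw w -> (p.+1 < size w)%N ->
  (nth 0 (bump pi w) p < nth 0 (bump pi w) p.+1) = (nth 0 w p < nth 0 w p.+1).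
Proof.
move=> r hp; case: (classic (exists i, marked pi w i)) => [[i m]|n]; last first.
  by rewrite bump_unmarked.
have [N [j [_ e mj rj]]] := bump_spec r m.
have hp' : (p.+1 < size (bump pi w))%N by rewrite size_bump.
have nb := reduced_adj_neq rj hp'; have nw := reduced_adj_neq r hp.
have mi k : marked pi (iter k (push pi) (w, i)).1 (iter k (push pi) (w, i)).2.
  by apply: marked_iter_push.
have si k : (p.+1 < size (iter k (push pi) (w, i)).1)%N by rewrite size_iter_push.
case: (ltP (nth 0 w p) (nth 0 w p.+1)) => h.
  have : weak_ascent p (iter N (push pi) (w, i)).
    elim: N {e} => [|N IH]; first by left.
    by rewrite iterS; apply: weak_ascent_push.
  by rewrite e => -[//|[]].
have : weak_descent p (iter N (push pi) (w, i)).
  elim: N {e} => [|N IH]; first by left; rewrite lt_neqAle h andbT; apply/eqP => e1; apply: nw.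
  by rewrite iterS; apply: weak_descent_push.
by rewrite e => -[/lt_gtF ->|[]].
Qed.

(* The Coxeter-Knuth move on a triple having exactly one descent. *)
Definition ck3 (x y z : int) : seq int :=
  if ((x < y) && (z < y)) || ((y < x) && (y < z)) then
    if x == z then [:: y; x; y]
    else if (x < z) == (x < y) then [:: y; x; z] else [:: x; z; y]
  else [:: x; y; z].

Fixpoint ck (p : nat) (w : seq int) : seq int :=
  match p, w with
  | 0, [:: x, y, z & t] => ck3 x y z ++ t
  | p'.+1, x :: t => x :: ck p' t
  | _, _ => w
  end.

Lemma ck_cat A x y z C : ck (size A) (A ++ [:: x; y; z] ++ C) = A ++ ck3 x y z ++ C.
Proof. by elim: A => //= a A ->. Qed.

(** The constructors are named after the pattern of [x y z] in letters [a < b < c]. The braid case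
    does not ask that the letters be consecutive; in a reduced triple they are. *)
Variant ck3_spec (x y z : int) : seq int -> Prop :=
  | Ck3_acb of x < z & z < y : ck3_spec x y z [:: y; x; z]
  | Ck3_cab of y < z & z < x : ck3_spec x y z [:: y; x; z]
  | Ck3_bca of z < x & x < y : ck3_spec x y z [:: x; z; y]
  | Ck3_bac of y < x & x < z : ck3_spec x y z [:: x; z; y]
  | Ck3_braid of x = z & x <> y : ck3_spec x y z [:: y; x; y]
  | Ck3_id of (x <= y <= z) || (z <= y <= x) : ck3_spec x y z [:: x; y; z].

Lemma ck3P x y z : ck3_spec x y z (ck3 x y z).
Proof.
rewrite /ck3; case: (ltgtP x y) => h1; case: (ltgtP z y) => h2;
  rewrite ?(ltNge y z) ?(ltW h2) ?h2 /= ?ltxx /=.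
all: try by (apply: Ck3_id; lia).
all: case: (ltgtP x z) => h3 /=; try by constructor; lia.
Qed.

(** * Bumps commute with Coxeter-Knuth moves *)

Lemma size_ck3 x y z : size (ck3 x y z) = 3%N.
Proof. by case: ck3P. Qed.

Lemma ck3K x y z : forall x' y' z', ck3 x y z = [:: x'; y'; z'] ->
  ck3 x' y' z' = [:: x; y; z].
Proof.
case: ck3P => h1 => [h2|h2|h2|h2|h2|] x' y' z' [<- <- <-];
  case: ck3P => // g1; try (move=> g2; congr [:: _; _; _]); lia.
Qed.

Lemma size_ck p w : size (ck p w) = size w.
Proof.
elim: p w => [|p IH] [|x w] //=; last by rewrite IH.
by case: w => [|y [|z w]] //; rewrite size_cat size_ck3.
Qed.

Lemma ck_small p w : (size w <= p.+2)%N -> ck p w = w.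
Proof.
by elim: p w => [|p IH] [|x w] //= h; [case: w h => [|y [|z w]] | rewrite IH].
Qed.

Variant ck_split_spec p (w : seq int) : Prop :=
  CkSplit A x y z C of size A = p & w = A ++ [:: x; y; z] ++ C.

Lemma ck_split p w : (p.+2 < size w)%N -> ck_split_spec p w.
Proof.
move=> h; apply: (@CkSplit _ _ (take p w) (nth 0 w p) (nth 0 w p.+1) (nth 0 w p.+2)
   (drop p.+3 w)); first by rewrite size_takel //; lia.
by rewrite /= -!drop_nth ?cat_take_drop //; lia.
Qed.

Lemma ckK p : involutive (ck p).
Proof.
move=> w; case: (leqP (size w) p.+2) => h; first by rewrite !ck_small.
case: (ck_split h) => A x y z C <- ->; rewrite ck_cat.
move: (size_ck3 x y z) (@ck3K x y z); case: (ck3 x y z) => [|x' [|y' [|z' []]]] // _ K.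
by rewrite ck_cat (K x' y' z').
Qed.

Lemma ck3_perm x y z : reducedw [:: x; y; z] ->
  perm_of (ck3 x y z) =1 perm_of [:: x; y; z].
Proof.
move=> r t; case: ck3P => //= h1 h2; try by rewrite s_trC //; lia.
  by congr (s_tr x _); rewrite s_trC //; lia.
  by congr (s_tr x _); rewrite s_trC //; lia.
subst z.
case: (boolP ((x + 1 < y) || (y + 1 < x))) => h.
  suff : (3 <= 1)%N by [].
  by apply: (r [:: y]) => s /=; rewrite (s_trC _ h) s_trK.
have [->|->] : y = x + 1 \/ x = y + 1 by lia.
  by rewrite s_tr_braid.
by rewrite -s_tr_braid.
Qed.

Lemma ck_perm p w : reducedw w -> perm_of (ck p w) =1 perm_of w.
Proof.
case: (leqP (size w) p.+2) => h; first by rewrite ck_small.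
case: (ck_split h) => A x y z C <- -> r; rewrite ck_cat.
by apply: perm_of_ctx; apply: ck3_perm; exact: reduced_factor r.
Qed.

Lemma ck_reduced p w : reducedw w -> reducedw (ck p w).
Proof. by move=> r; apply: (reduced_eq r); [exact: ck_perm | exact: size_ck]. Qed.

Lemma marked_transfer pi w w' j j' : marked pi w j -> size w' = size w ->
  (j' < size w')%N -> perm_of (del j' w') =1 perm_of (del j w) -> marked pi w' j'.
Proof.
move=> [hj [r e]] s hj' ed; split=> //; split; last by move=> x; rewrite ed.
by apply: (reduced_eq r ed); rewrite (size_del hj') (size_del hj) s.
Qed.

(* Where a move at a peak [x < y > z] takes the letter of index [k]; in a braid
   move the outer letters are exchanged, so that the crossings correspond. *)
Definition ck_mark3 (x z : int) (k : nat) : nat :=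
  nth 0%N (if x < z then [:: 1; 0; 2]%N
           else if z < x then [:: 0; 2; 1]%N else [:: 2; 1; 0]%N) k.

Definition ck_mark p (x z : int) (i : nat) : nat :=
  if (p <= i < p + 3)%N then (p + ck_mark3 x z (i - p))%N else i.

(** Peaks suffice because a move at a valley is the inverse of a move at a peak. The last condition
    replaces reducedness, which the words inside a bump lack. *)
Definition peak3 (x y z : int) : Prop := [/\ x < y, z < y & x = z -> y = x + 1].

Definition ck_related p (s s' : seq int * nat) : Prop :=
  exists A x y z C, [/\ size A = p, peak3 x y z, s.1 = A ++ [:: x; y; z] ++ C,
    s'.1 = A ++ ck3 x y z ++ C & s'.2 = ck_mark p x z s.2].

Lemma peak3_perm x y z : peak3 x y z -> perm_of (ck3 x y z) =1 perm_of [:: x; y; z].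
Proof.
move=> [h1 h2 h3] t; case: ck3P => //= g1 g2; try by rewrite s_trC //; lia.
  by congr (s_tr x _); rewrite s_trC //; lia.
by subst z; rewrite (h3 erefl) s_tr_braid.
Qed.

Lemma peak3_del x y z k : peak3 x y z -> (k < 3)%N ->
  perm_of (del (ck_mark3 x z k) (ck3 x y z)) =1 perm_of (del k [:: x; y; z]).
Proof.
move=> [h1 h2 h3] hk t; rewrite /ck_mark3.
case: ck3P => [g1 g2|g1 g2|g1 g2|g1 g2|g1 g2|g1]; [ | lia | | lia | | lia].
- rewrite g1; case: k hk => [|[|[|]]] //= _; by rewrite s_trC //; lia.
- have -> : (x < z) = false by lia.
  rewrite g1; case: k hk => [|[|[|]]] //= _; by rewrite s_trC //; lia.
by subst z; rewrite ltxx; case: k hk => [|[|[|]]] //= _; rewrite !s_trK.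
Qed.

Lemma ck_mark3_lt x z k : (ck_mark3 x z k < 3)%N.
Proof.
by rewrite /ck_mark3; (case: ifP => _; last case: ifP => _);
  case: k => [|[|[|k]]] //=; rewrite nth_nil.
Qed.

Lemma ck_mark_inj p x z : injective (ck_mark p x z).
Proof.
have inj3 k l : (k < 3)%N -> (l < 3)%N -> ck_mark3 x z k = ck_mark3 x z l -> k = l.
  rewrite /ck_mark3; (case: ifP => _; last case: ifP => _);
  by case: k => [|[|[|]]] //; case: l => [|[|[|]]].
move=> i j; rewrite /ck_mark.
have := ck_mark3_lt x z (i - p); have := ck_mark3_lt x z (j - p).
case: ifP => hi; case: ifP => hj h1 h2 e; try lia.
suff : (i - p = j - p)%N by lia.
by apply: inj3; lia.
Qed.

(** A single injective map of indices serves all marks, so the two marks of an unreduced word go to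
    the two marks of its partner. *)
Lemma ck_related_marked p s s' : ck_related p s s' ->
  exists sg, [/\ injective sg, s'.2 = sg s.2 & forall pi j,
    marked pi s.1 j -> marked pi s'.1 (sg j)
    /\ ck_related p (s.1, j) (s'.1, sg j)].
Proof.
move=> [A [x [y [z [C [sA pk e e' es]]]]]].
exists (ck_mark p x z); split=> //; first exact: ck_mark_inj.
move=> pi j m; split; last by exists A, x, y, z, C.
have ss : size s'.1 = size s.1 by rewrite e e' !size_cat size_ck3.
apply: (marked_transfer m) => //.
  have [hj _] := m; rewrite ss; move: hj; rewrite e !size_cat /= sA /ck_mark.
  have := ck_mark3_lt x z (j - p); case: ifP => //; lia.
rewrite e e' /ck_mark -sA.
case: (ltnP j (size A)) => hj.
  by rewrite !del_catl //; apply: perm_of_ctx; exact: peak3_perm.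
have [k {ss m hj}->] : exists k, j = (size A + k)%N by exists (j - size A)%N; lia.
rewrite andTb ltn_add2l addKn; case: ltnP => hk.
  have hl := ck_mark3_lt x z k.
  rewrite !del_catr !del_catl ?size_ck3 //; exact: perm_of_ctx (peak3_del pk hk).
have [l ->] : exists l, k = (3 + l)%N by exists (k - 3)%N; lia.
have d3 T : size T = 3%N -> del (size A + (3 + l)) (A ++ T ++ C) = A ++ T ++ del l C.
  by move=> sT; rewrite -sT !del_catr.
by rewrite !d3 ?size_ck3 //; apply: perm_of_ctx; exact: peak3_perm.
Qed.

Lemma ck_related_reduced p s s' : ck_related p s s' -> reducedw s.1 <-> reducedw s'.1.
Proof.
move=> [A [x [y [z [C [sA pk e e' es]]]]]].
have ss : size s'.1 = size s.1 by rewrite e e' !size_cat size_ck3.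
have ep : perm_of s'.1 =1 perm_of s.1.
  by rewrite e e'; apply: perm_of_ctx; exact: peak3_perm.
by split=> r; apply: (reduced_eq r) => // t; rewrite ep.
Qed.

Lemma ck_related_ck p s s' : ck_related p s s' -> s'.1 = ck p s.1.
Proof. by move=> [A [x [y [z [C [<- _ -> -> _]]]]]]; rewrite ck_cat. Qed.

(** * One push on both sides of a Coxeter-Knuth move *)

Lemma related_acb A C a b c k : a < b -> b < c -> (k < 3)%N ->
  ck_related (size A) (A ++ [:: a; c; b] ++ C, (size A + k)%N)
    (A ++ [:: c; a; b] ++ C, (size A + nth 0 [:: 1; 0; 2] k)%N).
Proof.
move=> h1 h2 hk; exists A, a, c, b, C; split=> //=; first by split; lia.
  by congr (_ ++ _); case: ck3P => [g1 g2|g1 g2|g1 g2|g1 g2|g1 g2|g1]; rewrite //=; lia.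
rewrite /ck_mark addKn /ck_mark3 h1; case: ifP => //; lia.
Qed.

Lemma related_bca A C a b c k : a < b -> b < c -> (k < 3)%N ->
  ck_related (size A) (A ++ [:: b; c; a] ++ C, (size A + k)%N)
    (A ++ [:: b; a; c] ++ C, (size A + nth 0 [:: 0; 2; 1] k)%N).
Proof.
move=> h1 h2 hk; exists A, b, c, a, C; split=> //=; first by split; lia.
  by congr (_ ++ _); case: ck3P => [g1 g2|g1 g2|g1 g2|g1 g2|g1 g2|g1]; rewrite //=; lia.
by rewrite /ck_mark addKn /ck_mark3 h1 (ltNge b a) (ltW h1) /=; case: ifP => //; lia.
Qed.

Lemma related_braid A C (i : int) k : (k < 3)%N ->
  ck_related (size A) (A ++ [:: i; i + 1; i] ++ C, (size A + k)%N)
    (A ++ [:: i + 1; i; i + 1] ++ C, (size A + nth 0 [:: 2; 1; 0] k)%N).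
Proof.
move=> hk; exists A, i, (i + 1), i, C; split=> //=; first by split; lia.
  by congr (_ ++ _); case: ck3P => [g1 g2|g1 g2|g1 g2|g1 g2|g1 g2|g1]; rewrite //=; lia.
by rewrite /ck_mark addKn /ck_mark3 ltxx; case: ifP => //; lia.
Qed.

(* From the marked word [t] the next word occurring in the bump that is not
   known to be unreduced: either [t] itself or its successor. *)
Definition push_maybe pi (t u : seq int * nat) : Prop :=
  u = t \/ (~ reducedw t.1 /\ u = push pi t).

Lemma push_maybe_refl pi t : push_maybe pi t t.
Proof. by left. Qed.

(** Two letters of the triple with equivalent deletions are both marked, which already proves that
    the whole word is unreduced and determines the next push. *)
Lemma push_maybe_next pi A T C k l : marked pi (A ++ T ++ C) (size A + k) ->
  k != l -> (k < size T)%N -> (l < size T)%N ->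
  perm_of (del l T) =1 perm_of (del k T) ->
  push_maybe pi (A ++ T ++ C, (size A + k)%N) (A ++ shift 1 l T ++ C, (size A + l)%N).
Proof.
move=> m kl hk hl ed.
have m' : marked pi (A ++ T ++ C) (size A + l)%N.
  apply: (marked_perm m); first by rewrite !size_cat; lia.
  by rewrite !del_catr !del_catl //; exact: perm_of_ctx.
have ne : (size A + l)%N <> (size A + k)%N by lia.
right; split; first exact: marked_unreduced m m' ne.
by rewrite (push_unreduced m m' ne) shift_catr shift_catl.
Qed.

Lemma shift_triple d A T C k : (k < size T)%N ->
  shift d (size A + k) (A ++ T ++ C) = A ++ shift d k T ++ C.
Proof. by move=> h; rewrite shift_catr shift_catl. Qed.

Definition shifts_related pi p (t t' : seq int * nat) : Prop :=
  exists u u', [/\ push_maybe pi t u, push_maybe pi t' u' & ck_related p u u'].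

Section TripleSteps.
Variables (pi : SZ) (A C : seq int).
Notation st T k := (A ++ T ++ C, (size A + k)%N).
Notation mk T k := (marked pi (A ++ T ++ C) (size A + k)).

(** If the raised letter stays clear of the others, the pattern persists. If it reaches the next
    larger letter, the two equal letters are adjacent on one side; on the other side they are
    usually separated by a letter commuting with them, so both sides push on. *)
Lemma acb_step (a b c : int) k : a < b -> b < c -> (k < 3)%N ->
  mk [:: a; c; b] k -> mk [:: c; a; b] (nth 0%N [:: 1; 0; 2]%N k) ->
  shifts_related pi (size A) (st (shift 1 k [:: a; c; b]) k)
    (st (shift 1 (nth 0%N [:: 1; 0; 2]%N k) [:: c; a; b]) (nth 0%N [:: 1; 0; 2]%N k)).
Proof.
move=> ab bc hk /(marked_shift 1); rewrite shift_triple // => m.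
move=> /(marked_shift 1); rewrite shift_triple; last by case: k hk {m} => [|[|[|]]].
case: k hk m => [|[|[|]]] //= _ m m'; rewrite /shift /= in m m' *.
- case: (ltP (a + 1) b) => h.
    exists (st [:: a + 1; c; b] 0), (st [:: c; a + 1; b] 1).
    by split; [left | left | exact: related_acb].
  have eb : b = a + 1 by lia. subst b.
  have n' := @push_maybe_next pi A [:: c; a + 1; a + 1] C 1%N 2%N m' isT isT isT.
  rewrite /shift /= in n'.
  case: (ltP (a + 1 + 1) c) => h'.
    have n := @push_maybe_next pi A [:: a + 1; c; a + 1] C 0%N 2%N m isT isT isT;
      rewrite /shift /= in n.
    exists (st [:: a + 1; c; a + 1 + 1] 2), (st [:: c; a + 1; a + 1 + 1] 2); split.
    + by apply: n => t /=; rewrite s_trC //; lia.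
    + exact: n'.
    + by apply: related_acb => //; lia.
  (* Here the separating letter does not commute: the left triple is a braid and stays put, while
     the right one makes one more push. *)
  have ec : c = a + 1 + 1 by lia. subst c.
  exists (st [:: a + 1; a + 1 + 1; a + 1] 0), (st [:: a + 1 + 1; a + 1; a + 1 + 1] 2).
  by split; [left | exact: n' | exact: related_braid].
- exists (st [:: a; c + 1; b] 1), (st [:: c + 1; a; b] 0).
  by split; [left | left | apply: related_acb => //; lia].
- case: (ltP (b + 1) c) => h.
    exists (st [:: a; c; b + 1] 2), (st [:: c; a; b + 1] 2).
    by split; [left | left | apply: related_acb => //; lia].
  have ec : c = b + 1 by lia. subst c.
  have n := @push_maybe_next pi A [:: a; b + 1; b + 1] C 2%N 1%N m isT isT isT;
    rewrite /shift /= in n.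
  have n' := @push_maybe_next pi A [:: b + 1; a; b + 1] C 2%N 0%N m' isT isT isT;
    rewrite /shift /= in n'.
  exists (st [:: a; b + 1 + 1; b + 1] 1), (st [:: b + 1 + 1; a; b + 1] 0); split.
  + exact: n.
  + by apply: n' => t /=; rewrite s_trC //; lia.
  + by apply: related_acb => //; lia.
Qed.

Lemma bca_step (a b c : int) k : a < b -> b < c -> (k < 3)%N ->
  mk [:: b; c; a] k -> mk [:: b; a; c] (nth 0%N [:: 0; 2; 1]%N k) ->
  shifts_related pi (size A) (st (shift 1 k [:: b; c; a]) k)
    (st (shift 1 (nth 0%N [:: 0; 2; 1]%N k) [:: b; a; c]) (nth 0%N [:: 0; 2; 1]%N k)).
Proof.
move=> ab bc hk /(marked_shift 1); rewrite shift_triple // => m.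
move=> /(marked_shift 1); rewrite shift_triple; last by case: k hk {m} => [|[|[|]]].
case: k hk m => [|[|[|]]] //= _ m m'; rewrite /shift /= in m m' *.
- case: (ltP (b + 1) c) => h.
    exists (st [:: b + 1; c; a] 0), (st [:: b + 1; a; c] 0).
    by split; [left | left | apply: related_bca => //; lia].
  have ec : c = b + 1 by lia. subst c.
  have n := @push_maybe_next pi A [:: b + 1; b + 1; a] C 0%N 1%N m isT isT isT;
    rewrite /shift /= in n.
  have n' := @push_maybe_next pi A [:: b + 1; a; b + 1] C 0%N 2%N m' isT isT isT;
    rewrite /shift /= in n'.
  exists (st [:: b + 1; b + 1 + 1; a] 1), (st [:: b + 1; a; b + 1 + 1] 2); split.
  + exact: n.
  + by apply: n' => t /=; rewrite s_trC //; lia.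
  + by apply: related_bca => //; lia.
- exists (st [:: b; c + 1; a] 1), (st [:: b; a; c + 1] 2).
  by split; [left | left | apply: related_bca => //; lia].
- case: (ltP (a + 1) b) => h.
    exists (st [:: b; c; a + 1] 2), (st [:: b; a + 1; c] 1).
    by split; [left | left | exact: related_bca].
  have eb : b = a + 1 by lia. subst b.
  have n' := @push_maybe_next pi A [:: a + 1; a + 1; c] C 1%N 0%N m' isT isT isT.
  rewrite /shift /= in n'.
  case: (ltP (a + 1 + 1) c) => h'.
    have n := @push_maybe_next pi A [:: a + 1; c; a + 1] C 2%N 0%N m isT isT isT;
      rewrite /shift /= in n.
    exists (st [:: a + 1 + 1; c; a + 1] 0), (st [:: a + 1 + 1; a + 1; c] 0); split.
    + by apply: n => t /=; rewrite s_trC //; lia.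
    + exact: n'.
    + by apply: related_bca => //; lia.
  have ec : c = a + 1 + 1 by lia. subst c.
  exists (st [:: a + 1; a + 1 + 1; a + 1] 2), (st [:: a + 1 + 1; a + 1; a + 1 + 1] 0).
  by split; [left | exact: n' | exact: related_braid].
Qed.

(** Raising an outer letter of the left triple makes it equal to the middle one; the extra push
    there gives a commutation pattern, which the right side has at once. *)
Lemma braid_step (i : int) k : (k < 3)%N ->
  mk [:: i; i + 1; i] k -> mk [:: i + 1; i; i + 1] (nth 0%N [:: 2; 1; 0]%N k) ->
  shifts_related pi (size A) (st (shift 1 k [:: i; i + 1; i]) k)
    (st (shift 1 (nth 0%N [:: 2; 1; 0]%N k) [:: i + 1; i; i + 1]) (nth 0%N [:: 2; 1; 0]%N k)).
Proof.
move=> hk m0 /(marked_shift 1) m'.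
have m := marked_shift 1 m0; move: m m'.
rewrite !shift_triple //; last by case: k hk {m0} => [|[|[|]]].
case: k hk m0 => [|[|[|]]] //= _ m0 m m'; rewrite /shift /= in m m' *.
- have n := @push_maybe_next pi A [:: i + 1; i + 1; i] C 0%N 1%N m isT isT isT;
  rewrite /shift /= in n.
  exists (st [:: i + 1; i + 1 + 1; i] 1), (st [:: i + 1; i; i + 1 + 1] 2).
  by split; [exact: n | left | apply: related_bca => //; lia].
(* The middle letter cannot be marked, since deleting it leaves [i] twice in a row. *)
- case: m0 => _ [r _]; move: r; rewrite del_catr => /(@reduced_factor A [:: i; i] C) r.
  suff : (2 <= 0)%N by [].
  by apply: (r [::]) => t /=; rewrite s_trK.
- have n := @push_maybe_next pi A [:: i; i + 1; i + 1] C 2%N 1%N m isT isT isT;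
  rewrite /shift /= in n.
  exists (st [:: i; i + 1 + 1; i + 1] 1), (st [:: i + 1 + 1; i; i + 1] 0).
  by split; [exact: n | left | apply: related_acb => //; lia].
Qed.

End TripleSteps.

Lemma related_shift pi p w w' j j' : marked pi w j -> marked pi w' j' ->
  ck_related p (w, j) (w', j') ->
  shifts_related pi p (shift 1 j w, j) (shift 1 j' w', j').
Proof.
move=> m m' [A [x [y [z [C [sA [h1 h2 h3] e e' es]]]]]].
move: e e' es; rewrite [(w, j).1]/= [(w', j').1]/= [(w, j).2]/= [(w', j').2]/= => e e' es.
case: (ltnP j p) => hj.
  have ej : j' = j by rewrite es /ck_mark; case: ifP => //; lia.
  rewrite ej e e' !shift_catl ?sA //.
  eexists _, _; split; [exact: push_maybe_refl | exact: push_maybe_refl |].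
  exists (shift 1 j A), x, y, z, C; split=> //=; first by rewrite size_shift ?sA.
  by rewrite /ck_mark; case: ifP => //; lia.
case: (ltnP j (p + 3)) => hj'; last first.
  have ej : j' = j by rewrite es /ck_mark; case: ifP => //; lia.
  have [l el] : exists l, j = (size A + (3 + l))%N by exists (j - p - 3)%N; lia.
  have d3 T : size T = 3%N -> shift 1 j (A ++ T ++ C) = A ++ T ++ shift 1 l C.
    by move=> sT; rewrite el -sT !shift_catr.
  rewrite ej e e' !d3 ?size_ck3 //.
  eexists _, _; split; [exact: push_maybe_refl | exact: push_maybe_refl |].
  exists A, x, y, z, (shift 1 l C); split=> //=.
  by rewrite -{1}ej.
have [k ek] : exists k, j = (size A + k)%N by exists (j - size A)%N; lia.
have hk : (k < 3)%N by lia.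
have {es} : j' = (size A + ck_mark3 x z k)%N.
  rewrite es ek /ck_mark -sA addKn leq_addr ltn_add2l; case: ifP => //; lia.
move: m m'; rewrite e e' -sA ek {e e' hj hj' ek}.
move: (ck_mark3_lt x z k); rewrite /ck_mark3.
case: ck3P => [g1 g2|g1 g2|g1 g2|g1 g2|g1 g2|g1]; [ | lia | | lia | | lia].
- by rewrite g1 => hl m m' ej; subst j'; rewrite !shift_triple //; apply: acb_step.
- have -> : (x < z) = false by lia.
  by rewrite g1 => hl m m' ej; subst j'; rewrite !shift_triple //; apply: bca_step.
subst z; rewrite ltxx (h3 erefl) => hl m m' ej; subst j'; rewrite !shift_triple //.
exact: braid_step.
Qed.

Lemma related_push pi p s s' : marked pi s.1 s.2 -> marked pi s'.1 s'.2 ->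
  ck_related p s s' -> shifts_related pi p (push pi s) (push pi s').
Proof.
case: s s' => [w i] [w' i'] m m' rel.
have [sg [sg_inj /= ei H]] := ck_related_marked rel.
have rr := ck_related_reduced rel.
have [j [-> mj c]] := pushE m.
have [mj' relj] := H pi j mj.
suff -> : push pi (w', i') = (shift 1 (sg j) w', sg j) by exact: related_shift.
case: c => [[r ej]|[nr ne]] /=.
  by rewrite push_reduced ?ej -?ei //; apply/rr.
by apply: push_unreduced m' mj' _ => /=; rewrite ei => /sg_inj.
Qed.

Lemma push_maybe_iter pi t u : push_maybe pi (push pi t) u ->
  exists N, [/\ (0 < N)%N, u = iter N (push pi) t &
    forall M, (0 < M)%N -> (M < N)%N -> ~ reducedw (iter M (push pi) t).1].
Proof.
case=> [->|[nr ->]]; first by exists 1%N; split=> // M; lia.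
exists 2%N; split=> // M M0 M2; have -> : M = 1%N by lia.
exact: nr.
Qed.

Lemma first_return_add pi t N K : (0 < N)%N ->
  (forall M, (0 < M)%N -> (M < N)%N -> ~ reducedw (iter M (push pi) t).1) ->
  ~ reducedw (iter N (push pi) t).1 ->
  first_return pi (iter N (push pi) t) K -> first_return pi t (K + N).
Proof.
move=> N0 HN nr [K0 [rK HK]]; split; first lia.
rewrite iterD; split=> // M M0 hM.
case: (ltngtP M N) => h; [exact: HN | | by rewrite h].
have -> : M = (M - N + N)%N by lia.
by rewrite iterD; apply: HK; lia.
Qed.

Lemma first_return_sub pi t N K : (0 < N)%N ->
  (forall M, (0 < M)%N -> (M < N)%N -> ~ reducedw (iter M (push pi) t).1) ->
  ~ reducedw (iter N (push pi) t).1 -> first_return pi t K ->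
  exists L, [/\ K = (L + N)%N, (L < K)%N & first_return pi (iter N (push pi) t) L].
Proof.
move=> N0 HN nr [K0 [rK HK]].
have NK : (N < K)%N.
  rewrite ltnNge leq_eqVlt; apply/negP => /orP [/eqP e|h]; first by rewrite -e in nr.
  by case: (HN K).
exists (K - N)%N; have e : K = (K - N + N)%N by lia.
split=> //; first lia.
split; first lia.
rewrite -iterD -e; split=> // M M0 hM; rewrite -iterD; apply: HK; lia.
Qed.

(** One or two pushes on each side lead to related words again, passing only unreduced words.
    Related words are reduced together, so both sides return at the same stage though possibly at
    different times. *)
Lemma related_first_return pi p s s' K : marked pi s.1 s.2 -> marked pi s'.1 s'.2 ->
  ck_related p s s' -> first_return pi s K ->
  exists K', first_return pi s' K' /\
    (iter K' (push pi) s').1 = ck p (iter K (push pi) s).1.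
Proof.
elim/ltn_ind: K s s' => K IH s s' m m' rel fr.
have [u [u' [/push_maybe_iter [N [N0 eu HN]] /push_maybe_iter [N' [N0' eu' HN']] relu]]] :=
  related_push m m' rel.
have rr := ck_related_reduced relu; rewrite eu eu' in rr.
have mu : marked pi u.1 u.2 by rewrite eu; exact: marked_iter_push.
have mu' : marked pi u'.1 u'.2 by rewrite eu'; exact: marked_iter_push.
case: (classic (reducedw (iter N (push pi) s).1)) => r.
  have -> : K = N by apply: first_return_uniq fr _; split.
  exists N'; split; first by split=> //; split=> //; apply/rr.
  by rewrite -eu -eu'; exact: ck_related_ck relu.
have [L [eK hL frL]] := first_return_sub N0 HN r fr; rewrite -eu in frL.
have [L' [frL' e]] := IH L hL u u' mu mu' relu frL.
exists (L' + N')%N; split.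
  by apply: first_return_add => //; [move/rr | rewrite -eu'].
by rewrite eK !iterD -eu -eu'.
Qed.

Lemma bump_ck_peak pi w w' p i i' : reducedw w -> ck_related p (w, i) (w', i') ->
  marked pi w i -> bump pi w' = ck p (bump pi w).
Proof.
move=> r rel m; have [sg [_ ei' /(_ _ _ m) /= [m' rel']]] := ck_related_marked rel.
have [K fr] := @first_return_ex pi (w, i) m.
have [K' [fr' e]] := related_first_return (s := (w, i)) (s' := (w', sg i)) m m' rel' fr.
rewrite (bump_marked r m fr) (bump_marked _ m' fr') //.
exact/(ck_related_reduced rel).
Qed.

(** The crossings of a reduced word are the inversions of its permutation, so the marked crossing
    also occurs in [w']. *)
Lemma marked_ex_perm pi w w' i : reducedw w -> perm_of w' =1 perm_of w ->
  size w' = size w -> marked pi w i -> exists j, marked pi w' j.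
Proof.
move=> r ep s m; have [hi _] := m.
pose c := nth (0, 0) (cross w) i.
have hc : c.1 < c.2 by exact: nth_cross_lt.
have : (c.1, c.2) \in cross w'.
  rewrite -uniq_cross_inv // ?ep ?uniq_cross_inv //; try exact: reduced_uniq_cross.
    by rewrite -surjective_pairing mem_nth ?size_cross.
  by apply: reduced_uniq_cross; exact: reduced_eq r ep s.
rewrite -surjective_pairing => /(nthP (0, 0)) [j]; rewrite size_cross => hj ej.
exists j; apply: (marked_transfer m s hj) => x.
by rewrite !perm_of_del // ej ep.
Qed.

Lemma bump_ck pi w p : reducedw w -> bump pi (ck p w) = ck p (bump pi w).
Proof.
move=> r; have r' : reducedw (ck p w) by exact: ck_reduced.
case: (classic (exists i, marked pi w i)) => [[i m]|n]; last first.
  rewrite !bump_unmarked // => -[i m]; apply: n; apply: marked_ex_perm m => //.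
    by move=> x; rewrite ck_perm.
  by rewrite size_ck.
case: (leqP (size w) p.+2) => h; first by rewrite !ck_small ?size_bump.
case: (ck_split h) => A x y z C sA ew.
have r3 : reducedw [:: x; y; z] by move: r; rewrite ew => /reduced_factor.
have valid u v t : reducedw [:: u; v; t] -> u = t -> (v = u + 1) \/ (u = v + 1).
  move=> ru e; subst t.
  case: (boolP ((u + 1 < v) || (v + 1 < u))) => h'.
    suff : (3 <= 1)%N by [].
    by apply: (ru [:: v]) => s /=; rewrite (s_trC _ h') s_trK.
  suff : u <> v by lia.
  move=> e; suff : (3 <= 1)%N by [].
  by apply: (ru [:: v]) => s /=; rewrite e s_trK.
case: (boolP ((x < y) && (z < y))) => [/andP [h1 h2]|h1].
  have rel : ck_related p (w, i) (ck p w, ck_mark p x z i).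
    exists A, x, y, z, C; split=> //=; last by rewrite ew -sA ck_cat.
    by split=> // e; have := valid _ _ _ r3 e; lia.
  exact: bump_ck_peak r rel m.
case: (boolP ((y < x) && (y < z))) => [/andP [g1 g2]|g1]; last first.
  have /= := reduced_adj_neq (p := 0) r3 isT; have /= := reduced_adj_neq (p := 1) r3 isT.
  move=> yz xy.
  (* On a monotone triple the move is trivial. Monotonicity is a matter of descents, which the bump
     preserves, so the move is trivial after the bump too. *)
  have ck_id v : reducedw v -> size v = size w ->
      (nth 0 v p < nth 0 v p.+1) = (x < y) -> (nth 0 v p.+1 < nth 0 v p.+2) = (y < z) ->
      ck p v = v.
    move=> rv sv; have hv : (p.+2 < size v)%N by rewrite sv.
    have n1 := reduced_adj_neq rv (ltnW hv); have n2 := reduced_adj_neq rv hv.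
    case: (ck_split hv) n1 n2 => A' x' y' z' C' <- ->; rewrite ck_cat.
    have nA k : nth 0 (A' ++ [:: x'; y'; z'] ++ C') (size A' + k) =
        nth 0 ([:: x'; y'; z'] ++ C') k by rewrite nth_cat ltnNge leq_addr addKn.
    rewrite -[size A']addn0 -!addnS !nA /= => n1 n2 e1 e2.
    suff -> : ck3 x' y' z' = [:: x'; y'; z'] by [].
    by case: ck3P => // k1 k2; lia.
  have nw k : (k < 3)%N -> nth 0 w (p + k) = nth 0 [:: x; y; z] k.
    move=> hk; rewrite ew -sA nth_cat ltnNge leq_addr addKn.
    by case: k hk => [|[|[|]]].
  have := nw 0%N isT; have := nw 1%N isT; have := nw 2%N isT.
  rewrite addn0 addn1 addn2 /= => w2 w1 w0.
  rewrite (ck_id w) ?w0 ?w1 ?w2 //.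
  rewrite ck_id ?size_bump ?bump_descent ?w0 ?w1 ?w2 //; [exact: bump_reduced | lia].
(* The triple is a valley: its image under the move is a peak, and the peak case is applied
   backwards. *)
have e3 : exists x' y' z', [/\ ck3 x y z = [:: x'; y'; z'], x' < y', z' < y' &
    x' = z' -> y' = x' + 1].
  case: ck3P => [k1 k2|k1 k2|k1 k2|k1 k2|k1 k2|k1]; [lia | | lia | | | lia];
    eexists _, _, _; (split; [reflexivity | lia | lia |]); try lia.
  by move=> _; have := valid _ _ _ r3 k1; lia.
have [x' [y' [z' [e3' l1 l2 l3]]]] := e3.
have ew' : ck p w = A ++ [:: x'; y'; z'] ++ C by rewrite ew -sA ck_cat e3'.
have [i' m'] := marked_ex_perm r (ck_perm p r) (size_ck p w) m.
have rel : ck_related p (ck p w, i') (w, ck_mark p x' z' i').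
  by exists A, x', y', z', C; split=> //=; rewrite (ck3K e3').
by rewrite (bump_ck_peak r' rel m') ckK.
Qed.

(** * Lowering operators as sequences of Coxeter-Knuth moves *)

(** The moves run from position [o + m - 1] down to [o], carrying the bumped letter leftwards;
    [unslide] runs upwards. *)
Fixpoint slide (o m : nat) (w : seq int) : seq int :=
  if m is m'.+1 then ck o (slide o.+1 m' w) else w.

Fixpoint unslide (o m : nat) (w : seq int) : seq int :=
  if m is m'.+1 then unslide o.+1 m' (ck o w) else w.

Lemma slideK o m : cancel (slide o m) (unslide o m).
Proof. by elim: m o => //= m IH o w; rewrite ckK IH. Qed.

Lemma slide_reduced o m w : reducedw w -> reducedw (slide o m w).
Proof. by move=> r; elim: m o => //= m IH o; apply: ck_reduced. Qed.

Lemma unslide_reduced o m w : reducedw w -> reducedw (unslide o m w).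
Proof. by elim: m o w => //= m IH o w r; apply: IH; apply: ck_reduced. Qed.

Lemma size_slide o m w : size (slide o m w) = size w.
Proof. by elim: m o => //= m IH o; rewrite size_ck. Qed.

(* Edelman-Greene row insertion of [b] into [a], returning the bumped letter. *)
Fixpoint row_insert (b : int) (a : seq int) : int * seq int :=
  if a is x :: a' then
    if x < b then ((row_insert b a').1, x :: (row_insert b a').2)
    else if x == b then (b + 1, a) else (x, b :: a')
  else (b, [::]).

Lemma incr_cons x a : incr_word (x :: a) -> incr_word a /\ {in a, forall z, x < z}.
Proof.
rewrite /incr_word /= (path_sortedE (@lt_trans _ _)) => /andP [/allP h s].
by split.
Qed.

Lemma row_insert_lt (b : int) (a : seq int) : {in a, forall z, b < z} -> a != [::] ->
  row_insert b a = (head 0 a, b :: behead a).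
Proof.
case: a => //= x a h _; have hx := h x (mem_head _ _).
by rewrite ltNge (ltW hx) /= gt_eqF.
Qed.

Lemma row_insert_bumped (b : int) (a : seq int) : a != [::] -> b < last 0 a ->
  b < (row_insert b a).1.
Proof.
elim: a => // x a IH _ hl /=; case: (ltgtP x b) => h //=; last by lia.
case: (altP (a =P [::])) hl => [-> /=|a0 hl]; first by lia.
by apply: IH => //; case: a a0 hl.
Qed.

Lemma row_insert_head (b : int) (a : seq int) : a != [::] ->
  exists h t, (row_insert b a).2 = h :: t /\ h <= b.
Proof.
case: a => // x a _ /=; case: (ltgtP x b) => h /=; do 2 eexists; split; eauto; lia.
Qed.

Lemma row_insert_mem (b : int) (a : seq int) z : z \in (row_insert b a).2 ->
  z = b \/ z \in a.
Proof.
elim: a => //= x a IH; case: (ltgtP x b) => h /=; rewrite !inE.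
- by case/orP=> [->|/IH [->|->]]; rewrite ?orbT; auto.
- by case/orP=> [/eqP ->|->]; rewrite ?orbT; auto.
- by auto.
Qed.

(** The tail is treated first, which leaves one move on the first letter [x], the letter bumped from
    the tail and the new head of the tail. The triple has pattern [acb] for [x < b], [bca] for
    [x > b], and is a braid for [x = b]; the last case needs [b + 1] in [a]. The word [a] followed
    by [b] contains [(size a).-1] triples. *)
Lemma slide_row_insert (a A : seq int) (b : int) C : incr_word a -> a != [::] ->
  b < last 0 a -> (b \in a -> b + 1 \in a) ->
  slide (size A) (size a).-1 (A ++ a ++ b :: C) =
  A ++ (row_insert b a).1 :: (row_insert b a).2 ++ C.
Proof.
elim: a A => // x a IH A /incr_cons [ia hx] _ hl hb.
case: (altP (a =P [::])) hl => [-> /= hl|a0].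
  by rewrite ltNge (ltW hl) /= gt_eqF.
have -> /= : last 0 (x :: a) = last 0 a by case: a a0 {IH ia hx hb}.
move=> hl.
have -> : size a = (size a).-1.+1 by case: a a0 {IH ia hx hl hb}.
have hba : b \in a -> b + 1 \in a.
  move=> ba; have := hx _ ba; have : b \in x :: a by rewrite inE ba orbT.
  by move/hb; rewrite inE => /orP [/eqP|//]; lia.
rewrite [LHS]/= -cat_rcons -(size_rcons A x) IH // cat_rcons.
have ckA y h t : ck (size A) (A ++ x :: y :: (h :: t) ++ C) = A ++ ck3 x y h ++ t ++ C.
  exact: (@ck_cat A x y h (t ++ C)).
case: (ltgtP x b) => h /=.
- have [z [t [e hz]]] := row_insert_head b a0; have hy := row_insert_bumped a0 hl.
  have xz : x < z.
    have : z \in (row_insert b a).2 by rewrite e mem_head.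
    by move/row_insert_mem => [->//|]; exact: hx.
  rewrite e ckA; case: ck3P => //; lia.
- rewrite row_insert_lt //=; last by move=> z /hx; lia.
  rewrite ckA; case: a a0 {IH ia hl hba ckA hb} hx => //= z a _ hx.
  have hz := hx z (mem_head _ _).
  case: ck3P => //; lia.
- subst x; rewrite row_insert_lt //= ckA.
  have : b + 1 \in b :: a by apply: hb; exact: mem_head.
  rewrite inE => /orP [/eqP|]; first lia.
  case: a a0 ia hx {IH hl hba ckA hb} => //= z a _ /incr_cons [_ hz] hx.
  rewrite inE => hm; have {hm} -> : z = b + 1.
    have := hx z (mem_head _ _); move: hm => /orP [/eqP //|/hz]; lia.
  case: ck3P => //; lia.
Qed.

(** The first factor occupies [r] positions from [o], the second the next [s]; the test looks for a
    descent at the break. The bumped letter is left at [o], so the recursion starts at [o.+1] with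
    the same [r]. Undoing takes one move fewer, because the operator has shortened the first
    factor. *)
Fixpoint fop_path (s o r : nat) (w : seq int) : seq int :=
  if s is s'.+1 then
    if (0 < r)%N && (nth 0 w (o + r) < nth 0 w (o + r).-1) then
      unslide o r.-2 (fop_path s' o.+1 r (slide o r.-1 w))
    else w
  else w.

Fixpoint unpaired_size (s o r : nat) (w : seq int) : nat :=
  if s is s'.+1 then
    if (0 < r)%N && (nth 0 w (o + r) < nth 0 w (o + r).-1) then
      (unpaired_size s' o.+1 r (slide o r.-1 w)).-1
    else r
  else r.

Lemma fop_path_reduced s o r w : reducedw w -> reducedw (fop_path s o r w).
Proof.
elim: s o w => //= s IH o w rw; case: ifP => // _.
by apply: unslide_reduced; apply: IH; exact: slide_reduced.
Qed.

(** All that the crystal argument uses about a bump. Stated for any map of words, it also covers the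
    conjugate of a bump by [flip], which handles [eop]. *)
Record ck_natural (B : seq int -> seq int) : Prop := CkNatural {
  natural_reduced : forall w, reducedw w -> reducedw (B w);
  natural_size : forall w, reducedw w -> size (B w) = size w;
  natural_descent : forall w p, reducedw w -> (p.+1 < size w)%N ->
    (nth 0 (B w) p < nth 0 (B w) p.+1) = (nth 0 w p < nth 0 w p.+1);
  natural_ck : forall w p, reducedw w -> B (ck p w) = ck p (B w) }.

Section Natural.
Variables (B : seq int -> seq int) (hB : ck_natural B).

Lemma natural_slide o m w : reducedw w -> B (slide o m w) = slide o m (B w).
Proof.
by move=> r; elim: m o => //= m IH o; rewrite (natural_ck hB) ?IH //; exact: slide_reduced.
Qed.

Lemma natural_unslide o m w : reducedw w -> B (unslide o m w) = unslide o m (B w).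
Proof.
elim: m o w => //= m IH o w r; rewrite IH ?(natural_ck hB) //; exact: ck_reduced.
Qed.

Lemma natural_gt w p : reducedw w -> (p.+1 < size w)%N ->
  (nth 0 (B w) p.+1 < nth 0 (B w) p) = (nth 0 w p.+1 < nth 0 w p).
Proof.
move=> r hp; have hp' : (p.+1 < size (B w))%N by rewrite natural_size.
have := natural_descent hB r hp; have := reduced_adj_neq r hp.
have := reduced_adj_neq (natural_reduced hB r) hp'; lia.
Qed.

Lemma natural_cond s o r w : reducedw w -> (o + r + s.+1 <= size w)%N ->
  ((0 < r)%N && (nth 0 (B w) (o + r) < nth 0 (B w) (o + r).-1)) =
  ((0 < r)%N && (nth 0 w (o + r) < nth 0 w (o + r).-1)).
Proof. by case: r => //= r rw h; rewrite addnS natural_gt //; lia. Qed.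

Lemma natural_fop_path s o r w : reducedw w -> (o + r + s <= size w)%N ->
  B (fop_path s o r w) = fop_path s o r (B w).
Proof.
elim: s o w => //= s IH o w rw h; rewrite (natural_cond rw h); case: ifP => // _.
have rs : reducedw (slide o r.-1 w) by exact: slide_reduced.
rewrite natural_unslide ?IH ?natural_slide ?size_slide //; first lia.
exact: fop_path_reduced.
Qed.

Lemma natural_unpaired_size s o r w : reducedw w -> (o + r + s <= size w)%N ->
  unpaired_size s o r (B w) = unpaired_size s o r w.
Proof.
elim: s o w => //= s IH o w rw h; rewrite (natural_cond rw h); case: ifP => // _.
have rs : reducedw (slide o r.-1 w) by exact: slide_reduced.
by rewrite -natural_slide // IH ?size_slide //; lia.
Qed.

End Natural.

(** * Unpaired letters and row insertion *)

(** One pairing step as seen from the first word: in an increasing word the first letter above [y]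
    is the smallest one. *)
Fixpoint drop_first_gt (y : int) (s : seq int) : seq int :=
  if s is x :: s' then if y < x then s' else x :: drop_first_gt y s' else [::].

Definition unmatched (a b : seq int) : seq int := foldr drop_first_gt a b.
Arguments unmatched : simpl never.

Lemma unmatched_step a y b : unmatched a (y :: b) = drop_first_gt y (unmatched a b).
Proof. by []. Qed.

Lemma pair_step1 y p : (pair_step y p).1 = drop_first_gt y p.1.
Proof.
case: p => s t; rewrite /pair_step /=.
have -> : drop_first_gt y s =
    if [seq x <- s | y < x] is x :: _ then rem x s else s.
  elim: s => //= x s ->; case: (ltP y x) => h; first by rewrite eqxx.
  case E : [seq _ <- s | _] => [|z u] //=; case: eqP => // e.
  have : z \in [seq x <- s | y < x] by rewrite E mem_head.
  by rewrite mem_filter -e ltNge h.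
by case: [seq _ <- s | _].
Qed.

Lemma unpaired1 a b : (unpaired a b).1 = unmatched a b.
Proof. by elim: b => //= y b IH; rewrite /unpaired /= pair_step1 IH. Qed.

Lemma incr_cat a1 a2 : incr_word (a1 ++ a2) ->
  [/\ incr_word a1, incr_word a2 & forall x z, x \in a1 -> z \in a2 -> x < z].
Proof.
rewrite /incr_word !(sorted_pairwise (@lt_trans _ _)) pairwise_cat.
by move=> /and3P [/allrelP h -> ->].
Qed.

Lemma incr_consI x a : incr_word a -> {in a, forall z, x < z} -> incr_word (x :: a).
Proof.
move=> i h; rewrite /incr_word /= (path_sortedE (@lt_trans _ _)); apply/andP.
by split=> //; apply/allP.
Qed.

Lemma incr_uniq a : incr_word a -> uniq a.
Proof. exact: (sorted_uniq (@lt_trans _ _) (@ltxx _ _)). Qed.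

Lemma drop_first_gt_sub y s : subseq (drop_first_gt y s) s.
Proof.
elim: s => //= x s IH; case: ifP => _; first exact: subseq_cons.
by rewrite eqxx.
Qed.

Lemma unmatched_sub a b : subseq (unmatched a b) a.
Proof.
elim: b => [|y b IH]; first exact: subseq_refl.
exact: subseq_trans (drop_first_gt_sub _ _) IH.
Qed.

Lemma incr_sub a b : subseq a b -> incr_word b -> incr_word a.
Proof. exact: (subseq_sorted (@lt_trans _ _)). Qed.

Lemma drop_first_gt_all y z s : {in s, forall x, z < x} -> y <= z ->
  drop_first_gt y s = behead s.
Proof.
by case: s => //= x s h yz; rewrite (le_lt_trans yz (h x (mem_head _ _))).
Qed.

(** For [y <= z], either both reach the same first letter, and both orders remove it and the next
    one, or [y] removes an earlier letter that [z] cannot reach. *)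
Lemma drop_first_gtC y z s : incr_word s ->
  drop_first_gt y (drop_first_gt z s) = drop_first_gt z (drop_first_gt y s).
Proof.
wlog yz : y z / y <= z.
  by move=> h i; case: (leP y z) => yz; [exact: h | rewrite (h z y) // ltW].
elim: s => //= x s IH /incr_cons [i hx].
case: (ltP z x) => zx; case: (ltP y x) => yx /=; rewrite ?zx ?(ltNge z) ?zx ?ltNge ?yx //=.
- by rewrite !(@drop_first_gt_all _ x) //; lia.
- by rewrite leNgt yx.
- by rewrite IH.
Qed.

(** The definition treats the smallest letter of the second word last; by commutation it may come
    first, as row insertion requires. *)
Lemma unmatched_cons a x b : incr_word a ->
  unmatched a (x :: b) = unmatched (drop_first_gt x a) b.
Proof.
move=> i; rewrite /unmatched /=; elim: b => //= y b <-.
by rewrite drop_first_gtC //; exact: incr_sub (unmatched_sub a b) i.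
Qed.

Lemma unmatched_catl a1 a2 b : (forall x y, x \in a1 -> y \in b -> x <= y) ->
  unmatched (a1 ++ a2) b = a1 ++ unmatched a2 b.
Proof.
elim: b => // y b IH h; rewrite !unmatched_step IH; last first.
  by move=> x z hx hz; apply: h; rewrite ?inE ?hz ?orbT.
elim: a1 h {IH} => //= x a1 IH h.
rewrite ltNge h ?mem_head //= IH // => u v hu hv; apply: h => //.
by rewrite inE hu orbT.
Qed.

Lemma next_up_spec x s : exists k : nat,
  [/\ next_up x s = x + k%:Z, x + k%:Z \notin s &
      forall j, (j < k)%N -> x + j%:Z \in s].
Proof.
pose P := fun k : nat => (x + k%:Z) \notin s.
exists (find P (iota 0 (size s).+1)); split=> //.
  (* Pigeonhole: [s] cannot contain [(size s).+1] distinct integers. *)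
  have hP : has P (iota 0 (size s).+1).
    apply/negPn/negP => /hasPn h.
    suff : ((size s).+1 <= size s)%N by rewrite ltnn.
    rewrite -{1}(size_iota 0 (size s).+1) -(size_map (fun k : nat => x + k%:Z)).
    apply: uniq_leq_size; first by rewrite map_inj_uniq ?iota_uniq // => i j; lia.
    by move=> z /mapP [k hk ->]; have := h k hk; rewrite /P negbK.
  have := nth_find 0%N hP; rewrite nth_iota //; by move: hP; rewrite has_find size_iota.
move=> j hj; have := before_find 0%N hj.
rewrite nth_iota ?add0n /P; first by move/negbFE.
by apply: leq_trans hj _; rewrite -{2}(size_iota 0 (size s).+1) find_size.
Qed.

Lemma next_upE x s (k : nat) : x + k%:Z \notin s ->
  (forall j, (j < k)%N -> x + j%:Z \in s) -> next_up x s = x + k%:Z.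
Proof.
move=> hk h; have [l [-> hl h']] := next_up_spec x s.
case: (ltngtP k l) => [/h'|/h|->] //; first by rewrite (negPf hk).
by rewrite (negPf hl).
Qed.

Lemma next_up_ge x s : x <= next_up x s.
Proof. by have [k [-> _ _]] := next_up_spec x s; lia. Qed.

Lemma next_up_notin x s : next_up x s \notin s.
Proof. by have [k [-> ? _]] := next_up_spec x s. Qed.

Lemma next_up_id x s : x \notin s -> next_up x s = x.
Proof. by move=> h; rewrite (@next_upE _ _ 0) ?addr0. Qed.

Lemma next_up_cons x b s : b < x -> next_up x (b :: s) = next_up x s.
Proof.
move=> bx; have [k [-> hk h]] := next_up_spec x s.
apply: next_upE; first by rewrite inE negb_or hk andbT; apply/eqP; lia.
by move=> j /h hj; rewrite inE hj orbT.
Qed.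

Lemma next_up_succ b s : next_up b (b :: s) = next_up (b + 1) s.
Proof.
have [k [-> hk h]] := next_up_spec (b + 1) s.
have e (j : nat) : b + j.+1%:Z = b + 1 + j%:Z by lia.
have h1 : b + k.+1%:Z \notin b :: s.
  by rewrite inE negb_or e hk andbT; apply/eqP; lia.
have h2 j : (j < k.+1)%N -> b + j%:Z \in b :: s.
  by case: j => [|j] hj; [rewrite addr0 mem_head | rewrite e inE h ?orbT].
by rewrite (next_upE h1 h2) e.
Qed.

Lemma le_incr a : incr_word a -> sorted <=%R a.
Proof. by apply: sub_sorted => x y; exact: ltW. Qed.

Lemma insertw_sorted y s : sorted <=%R (insertw y s).
Proof. exact: sort_le_sorted. Qed.

Lemma mem_insertw y s x : (x \in insertw y s) = (x == y) || (x \in s).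
Proof. by rewrite mem_sort inE. Qed.

Lemma insertw_cons b y s : b <= y -> {in s, forall z, b < z} ->
  insertw y (b :: s) = b :: insertw y s.
Proof.
move=> yb h; apply: le_sorted_eq; first exact: insertw_sorted.
  rewrite /= (path_sortedE (@le_trans _ _)) insertw_sorted andbT; apply/allP => z.
  by rewrite mem_insertw => /orP [/eqP ->//|/h /ltW].
rewrite /insertw perm_sort (perm_catCA [:: y] [:: b] s) /= perm_cons.
by rewrite perm_sym perm_sort.
Qed.

Lemma insertw_min y s : incr_word s -> {in s, forall z, y < z} -> insertw y s = y :: s.
Proof.
move=> i h; apply: le_sorted_eq; first exact: insertw_sorted.
  by apply: le_incr; exact: incr_consI.
by rewrite perm_sort.
Qed.

Lemma insertw_incr y s : incr_word s -> y \notin s -> incr_word (insertw y s).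
Proof.
move=> i h; rewrite /incr_word lt_sorted_uniq_le insertw_sorted andbT.
by rewrite sort_uniq /= h incr_uniq.
Qed.

Definition fpair (a b : seq int) : option (seq int * seq int) :=
  if (unpaired a b).1 is x :: u then
    let x := last x u in Some (rem x a, insertw (next_up x b) b)
  else None.

Lemma fpair_rcons a b u x : unmatched a b = rcons u x ->
  fpair a b = Some (rem x a, insertw (next_up x b) b).
Proof.
by rewrite /fpair unpaired1 => ->; case: u => [|z u] //=; rewrite last_rcons.
Qed.

Lemma fpair_ex a b c d : fpair a b = Some (c, d) -> exists u x,
  [/\ unmatched a b = rcons u x, c = rem x a & d = insertw (next_up x b) b].
Proof.
rewrite /fpair unpaired1; case: (unmatched a b) => // x u [<- <-].
by exists (belast x u), (last x u); rewrite -lastI.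
Qed.

Lemma rem_cat_notin (x : int) a1 a2 : x \notin a1 -> rem x (a1 ++ a2) = a1 ++ rem x a2.
Proof.
elim: a1 => //= y a1 IH; rewrite inE negb_or eq_sym => /andP [/negPf -> /IH ->]; by [].
Qed.

Lemma row_insert_cat b a1 a2 : {in a1, forall z, z < b} ->
  row_insert b (a1 ++ a2) = ((row_insert b a2).1, a1 ++ (row_insert b a2).2).
Proof.
elim: a1 => [|x a1 IH] h /=; first by case: row_insert.
rewrite h ?mem_head // IH //= => z hz; apply: h; by rewrite inE hz orbT.
Qed.

Lemma incr_split (b : int) a : b < last 0 a -> (b \in a -> b + 1 \in a) -> incr_word a ->
  a != [::] ->
  exists a1 y a2, {in a1, forall z, z < b} /\
    (a = a1 ++ y :: a2 /\ b < y \/ y = b + 1 /\ a = a1 ++ b :: y :: a2).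
Proof.
elim: a => // x a IH hl hb /incr_cons [ia hx] _.
case: (ltgtP x b) => h.
- case: (altP (a =P [::])) hl => [->|a0] /= hl; first lia.
  have hb' : b \in a -> b + 1 \in a.
    by move=> ba; have := hb; rewrite !inE ba orbT => /(_ isT) /orP [/eqP|//]; lia.
  have hl' : b < last 0 a by case: a a0 hl {IH hb ia hx hb'}.
  have [a1 [y [a2 [h1 h2]]]] := IH hl' hb' ia a0.
  exists (x :: a1), y, a2; split.
    by move=> z; rewrite inE => /orP [/eqP ->|/h1].
  by case: h2 => -[-> ->]; [left | right].
- by exists [::], x, a; split=> //; left.
- subst x; have := hb (mem_head _ _); rewrite inE => /orP [/eqP|]; first lia.
  case: a ia hx {IH hl hb} => // z a /incr_cons [_ hz] hx; rewrite inE => hm.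
  have ez : z = b + 1.
    have := hx z (mem_head _ _); move: hm => /orP [/eqP //|/hz]; lia.
  by exists [::], z, a; split=> //; right; rewrite ez.
Qed.

Lemma commute_large b s : {in s, forall z, b + 1 < z} ->
  perm_of (b :: rcons s b) =1 perm_of s.
Proof.
elim: s => [|x s IH] h t; first by rewrite /= s_trK.
rewrite /= -s_trC; last by have := h x (mem_head _ _); lia.
have /= -> := IH _ t; first by [].
by move=> z hz; apply: h; rewrite inE hz orbT.
Qed.

(** Without [b + 1], all letters of [a] after [b] exceed [b + 1], so the two copies of [b] could be
    brought together and cancelled. *)
Lemma reduced_repeat a b C : incr_word a -> reducedw (a ++ b :: C) -> b \in a ->
  b + 1 \in a.
Proof.
move=> ia; rewrite -cat_rcons => r ba; apply/negPn/negP => nb.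
move: ba ia r nb => /splitPr [a1 a2] /incr_cat [_ /incr_cons [_ h2] _].
rewrite mem_cat inE !negb_or -cats1 -!catA => r /and3P [_ _ nb].
have {}r : reducedw (b :: rcons a2 b).
  by apply: (@reduced_factor a1 _ C); rewrite -rcons_cons -cats1 -!catA.
have : (size (b :: rcons a2 b) <= size a2)%N.
  apply: r => t; rewrite commute_large // => z hz.
  have := h2 z hz; have : z <> b + 1 by move=> e; rewrite -e hz in nb.
  lia.
rewrite /= size_rcons; lia.
Qed.

Lemma unmatched_nil b : unmatched [::] b = [::].
Proof. by elim: b => // y b IH; rewrite unmatched_step IH. Qed.

(* Without a descent between [a] and [b] the operator moves the last letter of
   [a] to the front of [b], so it does not change the word [a ++ b]. *)
Lemma fpair_nodescent a b c d : incr_word a -> incr_word b ->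
  (forall x y, x \in a -> y \in b -> x < y) -> fpair a b = Some (c, d) ->
  c ++ d = a ++ b.
Proof.
move=> ia ib h /fpair_ex [u [x [e -> ->]]].
have ea : a = rcons u x.
  by rewrite -e -[X in unmatched X]cats0 unmatched_catl ?unmatched_nil ?cats0 //
    => y z hy /(h y z hy) /ltW.
have xa : x \in a by rewrite ea mem_rcons mem_head.
have xb : x \notin b by apply/negP => /(h _ _ xa); rewrite ltxx.
rewrite next_up_id // insertw_min //; last by move=> z; exact: h.
have := incr_uniq ia; rewrite ea rcons_uniq => /andP [xu _].
by rewrite -cats1 rem_cat_notin //= eqxx cats0 -catA.
Qed.

Lemma fpair_fst_size a b c d : fpair a b = Some (c, d) -> (size c).+1 = size a.
Proof.
move=> /fpair_ex [u [x [e -> _]]].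
have xa : x \in a.
  by apply: (mem_subseq (unmatched_sub a b)); rewrite e mem_rcons mem_head.
by rewrite (size_rem xa) prednK //; case: a xa e.
Qed.

(* The row insertion of [b1] leaves a pair of words with one more unmatched
   letter, on which [fpair] is again the row insertion of what it was on the
   original pair. *)
Lemma fpair_cons (a b : seq int) (b1 : int) C : incr_word a -> incr_word (b1 :: b) ->
  a != [::] -> b1 < last 0 a -> reducedw (a ++ b1 :: C) ->
  let y := (row_insert b1 a).1 in let a' := (row_insert b1 a).2 in
  size (unmatched a' b) = (size (unmatched a (b1 :: b))).+1 /\
  forall c d, fpair a (b1 :: b) = Some (c, d) -> exists z c' d',
    [/\ fpair a' b = Some (c', d'), d = z :: d', row_insert z c = (y, c') &
        [/\ z < y, y \in c & z \in c -> y = z + 1]].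
Proof.
move=> ia ib a0 hl r /=.
have [a1 [y [a2 [h1 h2]]]] := incr_split hl (reduced_repeat ia r) ia a0.
have [ib' hb] := incr_cons ib.
have b1lt : b1 < b1 + 1 by rewrite ltrDl.
have nb : b1 \notin b by apply/negP => /hb; rewrite ltxx.
have n1 : b1 \notin a1 by apply/negP => /h1; rewrite ltxx.
have le1 x z : x \in rcons a1 b1 -> z \in b -> x <= z.
  rewrite mem_rcons inE => /orP [/eqP -> /hb|/h1 hx /hb]; lia.
have le1' x z : x \in a1 -> z \in b -> x <= z.
  by move=> hx; apply: le1; rewrite mem_rcons inE hx orbT.
have le2 x z : x \in a1 -> z \in b1 :: b -> x <= z.
  by move=> /h1 hx; rewrite inE => /orP [/eqP ->|/hb]; lia.
case: h2 => -[h2 h3].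
- subst a; have [i1 i2 h12] := incr_cat ia; have [i2' hy] := incr_cons i2.
  have ny1 : y \notin a1 by apply/negP => /h1; rewrite ltNge (ltW h3).
  have insE R : row_insert b1 (a1 ++ y :: R) = (y, a1 ++ b1 :: R).
    by rewrite row_insert_cat //= ltNge (ltW h3) /= gt_eqF.
  rewrite insE /=.
  (* [b1] pairs with [y], the letter that its insertion bumps. In the inserted word [b1] lies below
     all of [b] and is the additional unmatched letter. *)
  have dropE : drop_first_gt b1 (a1 ++ y :: a2) = a1 ++ a2.
    elim: a1 h1 {ia hl r a0 n1 le1 le1' le2 i1 h12 ny1 insE} => [|x a1 IH] h1 /=.
      by rewrite h3.
    rewrite ltNge ltW ?h1 ?mem_head //= IH // => z hz.
    by apply: h1; rewrite inE hz orbT.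
  have eS : unmatched (a1 ++ y :: a2) (b1 :: b) = a1 ++ unmatched a2 b.
    by rewrite unmatched_cons // dropE unmatched_catl.
  have eS' : unmatched (a1 ++ b1 :: a2) b = a1 ++ b1 :: unmatched a2 b.
    by rewrite -cat_rcons unmatched_catl // cat_rcons.
  split; first by rewrite eS eS' !size_cat /= addnS.
  move=> c d /fpair_ex [u [x [e -> ->]]].
  move: e eS'; rewrite eS; have := mem_subseq (unmatched_sub a2 b).
  case/lastP: (unmatched a2 b) => [_|M x1 hM].
    (* All of [a2] is matched: the original pair moves the last letter [x] of [a1], the inserted
       pair moves [b1], and [z] is [x]. In the other case both move the same letter of [a2], and [z]
       is [b1]. *)
    rewrite cats0 => e1 eS'; subst a1.
    have hx : x < b1 by apply: h1; rewrite mem_rcons mem_head.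
    have xu : x \notin u.
      by have := incr_uniq i1; rewrite rcons_uniq => /andP [].
    have hu : {in u, forall z, z < x}.
      move=> z hz; move: i1; rewrite -cats1 => /incr_cat [_ _]; apply=> //.
      exact: mem_head.
    have xb : x \notin b1 :: b.
      by rewrite inE negb_or (lt_eqF hx) /=; apply/negP => /hb; rewrite ltNge (ltW hx).
    have xy : (y == x) = false by rewrite (gt_eqF (lt_trans hx h3)).
    have ec : rem x (rcons u x ++ y :: a2) = u ++ y :: a2.
      by rewrite cat_rcons rem_cat_notin //= eqxx.
    rewrite ec (next_up_id xb) insertw_min //; last first.
      by move=> z; rewrite inE => /orP [/eqP ->//|/hb]; exact: lt_trans hx.
    exists x, (u ++ x :: a2), (b1 :: b); split=> //.
    + rewrite (fpair_rcons (u := rcons u x) (x := b1)) ?eS' ?cats1 //.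
      by rewrite rem_cat_notin //= eqxx cat_rcons (next_up_id nb) insertw_min.
    + by rewrite row_insert_cat //= ltNge (ltW (lt_trans hx h3)) /= xy.
    + rewrite mem_cat mem_head orbT; split=> //; first exact: lt_trans hx h3.
      rewrite mem_cat inE (negPf xu) eq_sym xy /= => hx2.
      by have := lt_trans (lt_trans hx h3) (hy _ hx2); rewrite ltxx.
  rewrite -rcons_cat => /rcons_inj [_ <-] eS' {u x}.
  have hx : x1 \in a2 by apply: hM; rewrite mem_rcons mem_head.
  have yx := hy _ hx.
  have xa1 : x1 \notin a1.
    by apply/negP => hx1; have := h12 _ x1 hx1; rewrite inE hx orbT ltxx => /(_ isT).
  have xy : (y == x1) = false by rewrite (lt_eqF yx).
  have b1x : (b1 == x1) = false by rewrite (lt_eqF (lt_trans h3 yx)).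
  rewrite rem_cat_notin //= xy next_up_cons; last exact: lt_trans h3 yx.
  have le := next_up_ge x1 b; rewrite insertw_cons //;
    last exact: ltW (lt_le_trans (lt_trans h3 yx) le).
  exists b1, (a1 ++ b1 :: rem x1 a2), (insertw (next_up x1 b) b); split=> //.
  + by rewrite (fpair_rcons (u := a1 ++ b1 :: M) (x := x1)) ?eS' ?rcons_cat //
      rem_cat_notin //= b1x.
  + rewrite mem_cat mem_head orbT; split=> //.
    by rewrite mem_cat inE (negPf n1) (lt_eqF h3) /= => /mem_rem /hy; rewrite ltNge (ltW h3).
- subst y a; have [i1 i2 h12] := incr_cat ia; have [i2' hb2] := incr_cons i2.
  have [i3 hy] := incr_cons i2'.
  have insE R : row_insert b1 (a1 ++ b1 :: R) = (b1 + 1, a1 ++ b1 :: R).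
    by rewrite row_insert_cat //= ltxx eqxx.
  rewrite insE /=.
  have dropE : drop_first_gt b1 (a1 ++ b1 :: b1 + 1 :: a2) = a1 ++ b1 :: a2.
    elim: a1 h1 {ia hl r a0 n1 le1 le1' le2 i1 h12 insE} => [|x a1 IH] h1 /=.
      by rewrite ltxx b1lt.
    rewrite ltNge ltW ?h1 ?mem_head //= IH // => z hz.
    by apply: h1; rewrite inE hz orbT.
  have eS : unmatched (a1 ++ b1 :: b1 + 1 :: a2) (b1 :: b) = a1 ++ b1 :: unmatched a2 b.
    by rewrite unmatched_cons // dropE -cat_rcons unmatched_catl // cat_rcons.
  have eS' : unmatched (a1 ++ b1 :: b1 + 1 :: a2) b = a1 ++ b1 :: b1 + 1 :: unmatched a2 b.
    rewrite -cat_rcons -cat_rcons unmatched_catl; first by rewrite !cat_rcons.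
    move=> x z; rewrite mem_rcons inE => /orP [/eqP -> /hb h|]; [by rewrite lezD1 | exact: le1].
  split; first by rewrite eS eS' !size_cat /= !addnS.
  move=> c d /fpair_ex [u [x [e -> ->]]].
  move: e eS'; rewrite eS; have := mem_subseq (unmatched_sub a2 b).
  case/lastP: (unmatched a2 b) => [_|M x1 hM].
    (* The original pair moves [b1], which is already in the second word; the inserted pair moves
       [b1 + 1]. By [next_up_succ] both add the same letter. *)
    rewrite cats1 => /rcons_inj [_ <-] eS'.
    have nb1 : (b1 == b1 + 1) = false by rewrite (lt_eqF b1lt).
    have na1 : b1 + 1 \notin a1 by apply/negP => /h1; rewrite ltNge (ltW b1lt).
    rewrite rem_cat_notin //= eqxx next_up_succ.
    have le := next_up_ge (b1 + 1) b; rewrite insertw_cons //;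
    last exact: le_trans (ltW b1lt) le.
    exists b1, (a1 ++ b1 :: a2), (insertw (next_up (b1 + 1) b) b); split=> //.
    + rewrite (fpair_rcons (u := rcons a1 b1) (x := b1 + 1)) ?eS'.
        by rewrite rem_cat_notin //= nb1 eqxx.
      by rewrite -!cats1 -catA.
    + rewrite row_insert_cat //= [X in if X then _ else _]ltNge.
      by rewrite (ltW b1lt) /= eq_sym nb1.
    + by rewrite mem_cat mem_head orbT.
  rewrite -rcons_cons -rcons_cat => /rcons_inj [_ <-] eS' {u x}.
  have hx : x1 \in a2 by apply: hM; rewrite mem_rcons mem_head.
  have yx := hy _ hx.
  have xa1 : x1 \notin a1.
    by apply/negP => hx1; have := h12 _ x1 hx1; rewrite !inE hx !orbT ltxx => /(_ isT).
  have xy : (b1 + 1 == x1) = false by rewrite (lt_eqF yx).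
  have b1x : (b1 == x1) = false by rewrite (lt_eqF (lt_trans b1lt yx)).
  have eR : rem x1 (a1 ++ b1 :: b1 + 1 :: a2) = a1 ++ b1 :: b1 + 1 :: rem x1 a2.
    by rewrite rem_cat_notin //= b1x xy.
  rewrite eR next_up_cons; last exact: lt_trans b1lt yx.
  have le := next_up_ge x1 b; rewrite insertw_cons //;
    last exact: ltW (lt_le_trans (lt_trans b1lt yx) le).
  exists b1, (a1 ++ b1 :: b1 + 1 :: rem x1 a2), (insertw (next_up x1 b) b); split=> //.
  + rewrite (fpair_rcons (u := a1 ++ b1 :: b1 + 1 :: M) (x := x1)) ?eR //.
    by rewrite eS' rcons_cat.
  + by rewrite mem_cat !inE eqxx !orbT.
Qed.

Lemma row_insert_size b a : a != [::] -> b < last 0 a ->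
  size (row_insert b a).2 = size a.
Proof.
elim: a => // x a IH _ hl /=; case: (ltgtP x b) => h //=.
case: (altP (a =P [::])) hl => [-> /=|a0 hl]; first lia.
by rewrite IH //; move: a0 hl; case: (a).
Qed.

Lemma row_insert_incr b a : incr_word a -> a != [::] -> b < last 0 a ->
  incr_word (row_insert b a).2.
Proof.
elim: a => // x a IH ixa _ hl /=; have [ia hx] := incr_cons ixa.
case: (ltgtP x b) => h //=.
- case: (altP (a =P [::])) hl => [-> /=|a0 hl]; first lia.
  apply: incr_consI; first by apply: IH => //; move: a0 hl; case: (a).
  by move=> z /row_insert_mem [->//|/hx].
by apply: incr_consI => // z /hx; exact: lt_trans.
Qed.

Lemma nth_last_cat (A a B : seq int) : a != [::] ->
  nth 0 (A ++ a ++ B) (size A + size a).-1 = last 0 a.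
Proof.
case/lastP: a => // a x _; rewrite last_rcons size_rcons addnS /=.
by rewrite nth_cat ltnNge leq_addr addKn /= nth_cat size_rcons leqnn nth_rcons ltnn eqxx.
Qed.

Lemma nth_after_cat (A a B : seq int) :
  nth 0 (A ++ a ++ B) (size A + size a) = head 0 B.
Proof.
by rewrite nth_cat ltnNge leq_addr addKn /= nth_cat ltnn subnn nth0.
Qed.

Lemma nodescent_lt (a b : seq int) b1 : incr_word a -> incr_word (b1 :: b) ->
  last 0 a < b1 -> forall x y, x \in a -> y \in b1 :: b -> x < y.
Proof.
move=> ia /incr_cons [_ hb] hl x y xa yb.
have h1 : x <= last 0 a.
  case/lastP: a ia xa {hl} => // a z; rewrite -cats1 => /incr_cat [_ _ h].
  by rewrite last_cat mem_cat inE => /orP [/h|/eqP -> //]; move/(_ z (mem_head _ _))/ltW.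
have h2 : b1 <= y by move: yb; rewrite inE => /orP [/eqP ->|/hb /ltW].
exact: le_lt_trans h1 (lt_le_trans hl h2).
Qed.

(** Equality at the break is excluded, since a reduced word has no equal neighbours. *)
Lemma descent_cases (a b : seq int) b1 : incr_word a -> incr_word (b1 :: b) ->
  reducedw (a ++ b1 :: b) -> a != [::] -> (b1 < last 0 a) = false -> last 0 a < b1.
Proof.
move=> ia ib r a0 /negbT; rewrite -leNgt le_eqVlt => /orP [/eqP e|//].
case/lastP: a a0 ia r e => // a z _ _ r; rewrite last_rcons => e; subst z.
have := @reduced_adj_neq _ (size a) r; rewrite size_cat size_rcons /= => H.
case: H; first lia.
by rewrite cat_rcons nth_cat ltnn subnn nth_cat ltnNge leqnSn /= subSnn.
Qed.

Lemma unmatched_nodescent (a b : seq int) :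
  (forall x y, x \in a -> y \in b -> x < y) -> unmatched a b = a.
Proof.
move=> h; rewrite -[a in LHS]cats0 unmatched_catl ?unmatched_nil ?cats0 //.
by move=> x y xa yb; rewrite ltW ?h.
Qed.

Lemma insert_reduced a b b1 : incr_word a -> incr_word (b1 :: b) ->
  reducedw (a ++ b1 :: b) -> a != [::] -> b1 < last 0 a ->
  reducedw ((row_insert b1 a).2 ++ b).
Proof.
move=> ia ib r a0 hl.
have := slide_row_insert [::] b ia a0 hl (reduced_repeat ia r).
rewrite /= => e.
apply: (@reduced_factor [:: (row_insert b1 a).1] _ [::]); rewrite cats0 /= -e.
exact: slide_reduced.
Qed.

Lemma unpaired_sizeE (b A a C : seq int) : incr_word a -> incr_word b -> reducedw (a ++ b) ->
  unpaired_size (size b) (size A) (size a) (A ++ a ++ b ++ C) = size (unmatched a b).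
Proof.
elim: b A a => [|b1 b IH] A a ia ib r //=.
case: (altP (a =P [::])) => [->|a0]; first by rewrite unmatched_nil.
have sa : (0 < size a)%N by rewrite lt0n size_eq0.
rewrite nth_after_cat (nth_last_cat _ _ a0) sa /=.
case: ifP => hl; last first.
  by rewrite unmatched_nodescent //; exact: nodescent_lt ia ib (descent_cases ia ib r a0 hl).
rewrite (slide_row_insert _ _ ia a0 hl (reduced_repeat ia r)).
have := fpair_cons ia ib a0 hl r => -[es _].
rewrite -cat_rcons -(size_rcons A (row_insert b1 a).1) -{1}(row_insert_size a0 hl) IH.
- by rewrite es.
- exact: row_insert_incr.
- by case/incr_cons: ib.
- exact: insert_reduced.
Qed.

Lemma fop_pathE (b A a C c d : seq int) : incr_word a -> incr_word b -> reducedw (a ++ b) ->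
  fpair a b = Some (c, d) ->
  fop_path (size b) (size A) (size a) (A ++ a ++ b ++ C) = A ++ c ++ d ++ C.
Proof.
elim: b A a c d => [|b1 b IH] A a c d ia ib r hf /=.
  by rewrite [c ++ _]catA (fpair_nodescent ia ib _ hf) ?cats0.
case: (altP (a =P [::])) => [ea|a0].
  by move: hf => /fpair_fst_size; rewrite ea.
have sa : (0 < size a)%N by rewrite lt0n size_eq0.
rewrite nth_after_cat (nth_last_cat _ _ a0) sa /=.
case: ifP => hl; last first.
  rewrite [c ++ _]catA (fpair_nodescent ia ib _ hf) -?catA //.
  by exact: nodescent_lt ia ib (descent_cases ia ib r a0 hl).
rewrite (slide_row_insert _ _ ia a0 hl (reduced_repeat ia r)).
have := fpair_cons ia ib a0 hl r => -[_ /(_ _ _ hf) [z [c' [d' [hf' -> ins [zy yc hz]]]]]].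
have [ib' _] := incr_cons ib.
have := IH (rcons A (row_insert b1 a).1) _ _ _ (row_insert_incr ia a0 hl) ib'
  (insert_reduced ia ib r a0 hl) hf'.
rewrite size_rcons (row_insert_size a0 hl) !cat_rcons => ->.
have ic : incr_word c.
  have [u [x [_ -> _]]] := fpair_ex hf.
  by apply: incr_sub ia; exact: rem_subseq.
have c0 : c != [::] by case: c yc {hf ins hz ic}.
have zc : z < last 0 c.
  apply: lt_le_trans zy _; move: yc ic; case/lastP: c c0 {hf ins hz} => // c t _.
  rewrite last_rcons mem_rcons inE => /orP [/eqP -> //|hy].
  by rewrite -cats1 => /incr_cat [_ _ h]; apply/ltW/h => //; exact: mem_head.
have hzc : z \in c -> z + 1 \in c by move=> /hz <-.
(* Inserting [z] into [c] produces exactly the word reached by the recursion, so [unslide] turns it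
   back into [c] followed by [z :: d']. *)
have := slide_row_insert A (d' ++ C) ic c0 zc hzc.
rewrite ins /= -(fpair_fst_size hf) /= => <-.
by rewrite slideK.
Qed.

(** * Lowering operators on factorizations *)

Definition factorwise (B : seq int -> seq int) (w : seq (seq int)) : seq (seq int) :=
  reshape (shape w) (B (flatten w)).

Lemma factorwise_flatten B w : ck_natural B -> reducedw (flatten w) ->
  flatten (factorwise B w) = B (flatten w) /\ shape (factorwise B w) = shape w.
Proof.
move=> hB r; have e : size (B (flatten w)) = sumn (shape w).
  by rewrite (natural_size hB r) size_flatten.
by split; [rewrite reshapeKr ?e | rewrite reshapeKl ?e].
Qed.

Lemma incr_reshape sh (u v : seq int) : size u = size v ->
  (forall p, (p.+1 < size u)%N -> (nth 0 v p < nth 0 v p.+1) = (nth 0 u p < nth 0 u p.+1)) ->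
  all incr_word (reshape sh u) -> all incr_word (reshape sh v).
Proof.
elim: sh u v => //= n sh IH u v s h /andP [hu hs]; apply/andP; split.
  have st : size (take n v) = size (take n u) by rewrite !size_take s.
  apply/(sortedP 0) => i; rewrite st => hi; move/(sortedP 0)/(_ i hi): hu.
  move: hi; rewrite size_take_min leq_min => /andP [h1 h2].
  by rewrite !nth_take ?h // ltnW.
apply: IH hs; first by rewrite !size_drop s.
move=> p; rewrite size_drop !nth_drop addnS => hp; apply: h; lia.
Qed.

Lemma factorwise_isFact B n w : ck_natural B -> isFact n w -> isFact n (factorwise B w).
Proof.
move=> hB [s [i r]]; have [ef es] := factorwise_flatten hB r.
split; first by rewrite -(size_map size) -/shape es size_map.
split; last by rewrite ef; exact: natural_reduced.
rewrite /factorwise; apply: (@incr_reshape _ (flatten w)).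
- by rewrite (natural_size hB).
- by move=> p hp; exact: natural_descent.
by rewrite flattenK.
Qed.

Lemma fop_cat P a b S : fop (size P) (P ++ [:: a, b & S]) =
  omap (fun cd => P ++ [:: cd.1, cd.2 & S]) (fpair a b).
Proof.
rewrite /fop /fpair !nth_cat ltnn subnn ltnNge leqnSn /= subSnn /=.
case: (unpaired a b).1 => //= x u; congr Some.
by elim: P => //= p P ->.
Qed.

Lemma split_at n i (w : seq (seq int)) : size w = n -> (i.+1 < n)%N ->
  exists P a b S, size P = i /\ w = P ++ [:: a, b & S].
Proof.
move=> <- hi; exists (take i w), (nth [::] w i), (nth [::] w i.+1), (drop i.+2 w).
split; first by rewrite size_takel //; lia.
by rewrite -!drop_nth ?cat_take_drop //; lia.
Qed.

Lemma flatten_split P (a b : seq int) S :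
  flatten (P ++ [:: a, b & S]) = flatten P ++ a ++ b ++ flatten S.
Proof. by rewrite flatten_cat. Qed.

Lemma isFact_split n P a b S : isFact n (P ++ [:: a, b & S]) ->
  [/\ incr_word a, incr_word b & reducedw (a ++ b)].
Proof.
move=> [_ [h r]]; move: h; rewrite all_cat /= => /and4P [_ -> -> _]; split=> //.
by move: r; rewrite flatten_split [a ++ _]catA => /reduced_factor.
Qed.

Lemma fpair_incr a b c d : incr_word a -> incr_word b -> fpair a b = Some (c, d) ->
  incr_word c /\ incr_word d.
Proof.
move=> ia ib /fpair_ex [u [x [_ -> ->]]]; split.
  by apply: incr_sub ia; exact: rem_subseq.
by apply: insertw_incr => //; exact: next_up_notin.
Qed.

(** The new word is reached by Coxeter-Knuth moves, which keep it reduced. *)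
Lemma fop_isFact n i w v : isFact n w -> (i.+1 < n)%N -> fop i w = Some v -> isFact n v.
Proof.
move=> fw hi; have [s [al r]] := fw.
have [P [a [b [S [eP ew]]]]] := split_at s hi.
move: fw s al r; rewrite ew -eP fop_cat => fw s al r.
have [ia ib rab] := isFact_split fw.
case E : (fpair a b) => [[c d]|] //= [<-].
have [ic id] := fpair_incr ia ib E.
split; first by move: s; rewrite !size_cat.
split; first by move: al; rewrite !all_cat /= ia ib ic id.
move: r; rewrite !flatten_split.
rewrite -(fop_pathE (flatten P) (flatten S) ia ib rab E); exact: fop_path_reduced.
Qed.

Lemma cat_split_shape P a b (S v : seq (seq int)) : shape v = shape (P ++ [:: a, b & S]) ->
  exists P' a' b' S', [/\ v = P' ++ [:: a', b' & S'], shape P' = shape P,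
    size a' = size a, size b' = size b & shape S' = shape S].
Proof.
move=> e; have s : size v = size (P ++ [:: a, b & S]).
  by rewrite -(size_map size) -/shape e size_map.
have hi : ((size P).+1 < size v)%N by rewrite s size_cat /=; lia.
have [P' [a' [b' [S' [eP ev]]]]] := split_at (erefl (size v)) hi.
exists P', a', b', S'; move: e; rewrite ev /shape !map_cat.
move/eqP; rewrite eqseq_cat ?size_map // => /andP [/eqP -> /eqP /= [-> -> ->]].
by split.
Qed.

(** Equal numbers of unpaired letters make both sides zero together. Otherwise both are given by
    [fop_path] with the same parameters, which commutes with [B], and the break is moved in the same
    way. *)
Lemma fop_factorwise B n i w : ck_natural B -> isFact n w -> (i.+1 < n)%N ->
  fop i (factorwise B w) = omap (factorwise B) (fop i w).
Proof.
move=> hB fw hi; have [s [al r]] := fw.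
have fv := factorwise_isFact hB fw.
have [efl esh] := factorwise_flatten hB r.
have [P [a [b [S [eP ew]]]]] := split_at s hi.
move: esh; rewrite {2}ew => /cat_split_shape [P' [a' [b' [S' [ev sP sa sb sS]]]]].
have sP1 : size P' = size P by rewrite -(size_map size) -/shape sP size_map.
have sP2 : size (flatten P') = size (flatten P) by rewrite !size_flatten sP.
move: fv; rewrite ev => fv; rewrite ev in efl.
move: fw r efl; rewrite ew -eP => fw r efl.
rewrite -{1}sP1 !fop_cat.
have [ia ib rab] := isFact_split fw; have [ia' ib' rab'] := isFact_split fv.
have := unpaired_sizeE (flatten P) (flatten S) ia ib rab.
have := unpaired_sizeE (flatten P') (flatten S') ia' ib' rab'.
rewrite -!flatten_split efl sa sb sP2 natural_unpaired_size //; last first.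
  by rewrite flatten_split !size_cat; lia.
move=> -> es.
case E : (fpair a b) => [[c d]|]; case E' : (fpair a' b') => [[c' d']|] //=.
- congr Some; rewrite /factorwise.
  have e1 := fop_pathE (flatten P) (flatten S) ia ib rab E.
  have e2 := fop_pathE (flatten P') (flatten S') ia' ib' rab' E'.
  rewrite -!flatten_split in e1 e2.
  rewrite -e1 (natural_fop_path hB) //; last by rewrite flatten_split !size_cat; lia.
  rewrite -efl -sa -sb -sP2 e2 -[LHS]flattenK; congr reshape.
  rewrite /shape !map_cat /= -!/shape sP sS.
  have := fpair_fst_size E; have := fpair_fst_size E'; rewrite sa => <- /succn_inj ->.
  have [u [x [_ _ ->]]] := fpair_ex E; have [u' [x' [_ _ ->]]] := fpair_ex E'.
  by rewrite /insertw !size_sort /= sb.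
- exfalso; have [u [x [ex _ _]]] := fpair_ex E; move: es; rewrite ex size_rcons.
  by move: E'; rewrite /fpair unpaired1; case: (unmatched a' b').
- exfalso; have [u [x [ex _ _]]] := fpair_ex E'; move: es; rewrite ex size_rcons.
  by move: E; rewrite /fpair unpaired1; case: (unmatched a b).
Qed.

(** * Raising operators by duality *)

(* The symmetry [s_k -> s_(-k)], combined with word reversal, exchanges [eop] and
   [fop]. *)
Definition flip (w : seq int) : seq int := rev (@map int int -%R w).
Definition flip_fact (w : seq (seq int)) : seq (seq int) := rev (map flip w).

Lemma flipK : involutive flip.
Proof.
move=> w; rewrite /flip map_rev revK -map_comp map_id_in // => x _ /=.
by rewrite opprK.
Qed.

Lemma size_flip w : size (flip w) = size w.
Proof. by rewrite size_rev size_map. Qed.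

Lemma flip_cat u v : flip (u ++ v) = flip v ++ flip u.
Proof. by rewrite /flip map_cat rev_cat. Qed.

Lemma flip_cons x u : flip (x :: u) = rcons (flip u) (- x).
Proof. by rewrite /flip /= rev_cons. Qed.

Lemma mem_flip w x : (x \in flip w) = (- x \in w).
Proof. by rewrite mem_rev -{1}[x]opprK mem_map //; exact: oppr_inj. Qed.

Lemma flip_factK : involutive flip_fact.
Proof.
by move=> w; rewrite /flip_fact map_rev revK -map_comp map_id_in // => x _ /=; rewrite flipK.
Qed.

Lemma flatten_flip w : flatten (flip_fact w) = flip (flatten w).
Proof.
rewrite /flip_fact; elim: w => //= a w IH.
by rewrite rev_cons flatten_rcons IH flip_cat.
Qed.

Lemma shape_flip w : shape (flip_fact w) = rev (shape w).
Proof.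
rewrite /shape /flip_fact map_rev -map_comp; congr rev; apply: eq_map => a /=.
exact: size_flip.
Qed.

(** The reflection [x -> 1 - x] exchanges the pair [k], [k + 1] with the pair [- k], [- k + 1]. *)
Lemma perm_of_opp w x : perm_of (@map int int -%R w) x = 1 - perm_of w (1 - x).
Proof.
elim: w x => [|k w IH] x /=; first by lia.
by rewrite IH /s_tr; if_eq_cases; lia.
Qed.

Lemma reduced_rev w : reducedw w -> reducedw (rev w).
Proof.
move=> r v e; rewrite size_rev -(size_rev v); apply: r => x.
by apply: (@perm_of_inj v); rewrite perm_of_Krev e perm_of_revK.
Qed.

Lemma reduced_opp w : reducedw w -> reducedw (@map int int -%R w).
Proof.
move=> r v e; rewrite size_map -(@size_map int int -%R v); apply: r => x.
by rewrite perm_of_opp e perm_of_opp opprB addrCA subrr addr0 opprB addrCA subrr addr0.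
Qed.

Lemma flip_reduced w : reducedw w -> reducedw (flip w).
Proof. by move=> r; apply: reduced_rev; exact: reduced_opp. Qed.

Lemma nth_flip w p : (p < size w)%N -> @nth int 0 (flip w) p = - @nth int 0 w (size w - p.+1).
Proof.
move=> h; rewrite /flip nth_rev size_map // (@nth_map int 0 int 0) //; lia.
Qed.

Lemma flip_ck3 x y z : ck3 (- z) (- y) (- x) = flip (ck3 x y z).
Proof.
case: (ck3P x y z) => [g1 g2|g1 g2|g1 g2|g1 g2|g1 g2|g1]; rewrite /flip /rev /=;
  case: ck3P => // k1; try (move=> k2); try lia.
all: congr [:: _; _; _]; lia.
Qed.

Lemma flip_ck w p q : size w = (p + q + 3)%N -> flip (ck p w) = ck q (flip w).
Proof.
move=> s; have h : (p.+2 < size w)%N by lia.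
case: (ck_split h) => A x y z C sA ew.
have sq : size (flip C) = q by rewrite size_flip; move: s; rewrite ew !size_cat /=; lia.
rewrite ew -sA ck_cat !flip_cat -!catA -flip_ck3 -sq.
by rewrite -ck_cat.
Qed.

(** Negation and reversal each exchange ascents and descents, so [flip] preserves their kind and
    only mirrors the positions; Coxeter-Knuth moves are mirrored likewise. *)
Lemma flip_natural B : ck_natural B -> ck_natural (fun w => flip (B (flip w))).
Proof.
move=> hB; split=> [w r|w r|w p r hp|w p r].
- by apply: flip_reduced; apply: natural_reduced => //; exact: flip_reduced.
- by rewrite size_flip (natural_size hB) ?size_flip //; exact: flip_reduced.
- have rf := flip_reduced r.
  have sB : size (B (flip w)) = size w by rewrite (natural_size hB) // size_flip.
  rewrite !nth_flip ?sB ?(ltnW hp) // ltrN2.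
  have e1 : (size w - p.+1 = (size w - p.+2).+1)%N by lia.
  rewrite e1 (natural_descent hB) // ?size_flip -?e1; last by lia.
  rewrite !nth_flip; try lia.
  have -> : (size w - (size w - p.+2).+1 = p.+1)%N by lia.
  have -> : (size w - (size w - p.+1).+1 = p)%N by lia.
  by rewrite ltrN2.
have rf := flip_reduced r.
case: (leqP (size w) p.+2) => h.
  by rewrite !ck_small // size_flip (natural_size hB) // size_flip.
have s : size w = (p + (size w - p - 3) + 3)%N by lia.
rewrite (flip_ck s) (natural_ck hB) // (flip_ck (q := p)) //.
by rewrite (natural_size hB) // size_flip; lia.
Qed.

(** * The pairing seen from the other word *)

Fixpoint drop_last_lt (x : int) (s : seq int) : seq int :=
  if s is y :: s' then
    if has (fun z => z < x) s' then y :: drop_last_lt x s'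
    else if y < x then s' else s
  else [::].

Lemma mem_drop_last_lt x s z : z \in drop_last_lt x s -> z \in s.
Proof.
elim: s => //= y s IH; case: ifP => _; first by rewrite !inE => /orP [->//|/IH ->]; rewrite orbT.
by case: ifP => // _; rewrite inE orbC => ->.
Qed.

(* The pairing computed by running through the letters of the first word in
   increasing order, pairing each with the largest smaller unpaired letter. *)
Fixpoint pair_rev (a b : seq int) : seq int * seq int :=
  if a is x :: a' then
    if has (fun z => z < x) b then pair_rev a' (drop_last_lt x b)
    else (x :: (pair_rev a' b).1, (pair_rev a' b).2)
  else ([::], b).

Lemma pair_rev_nil a : pair_rev a [::] = (a, [::]).
Proof. by elim: a => //= x a ->. Qed.

(** The smallest letter [b1] is used only when no other letter is available. It thus takes the first
    letter above it among those that the rest of [b] leaves over, which is what [pair_step] does. *)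
Lemma pair_rev_cons a b1 b : {in b, forall z, b1 < z} ->
  pair_rev a (b1 :: b) = pair_step b1 (pair_rev a b).
Proof.
elim: a b => [|x a IH] b hb //=.
case: (boolP (has (fun z => z < x) b)) => hx.
  by rewrite orbT IH // => z /mem_drop_last_lt; exact: hb.
rewrite orbF; case: (ltP b1 x) => h.
  rewrite /= /pair_step /= h /= eqxx; by case: (pair_rev a b).
rewrite IH //; case: (pair_rev a b) => U T; rewrite /pair_step /= ltNge h /=.
case E : [seq _ <- U | _] => [|z u] //=.
have : z \in [seq x <- U | b1 < x] by rewrite E mem_head.
rewrite mem_filter => /andP [zb _]; by rewrite (lt_eqF (le_lt_trans h zb)).
Qed.

Lemma pair_revE a b : incr_word b -> pair_rev a b = unpaired a b.
Proof.
elim: b => [|y b IH] ib; first by rewrite pair_rev_nil.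
have [ib' hb] := incr_cons ib.
by rewrite pair_rev_cons // IH.
Qed.

Lemma drop_first_gt_rcons y s z : drop_first_gt y (rcons s z) =
  if has (fun x => y < x) s then rcons (drop_first_gt y s) z
  else if y < z then s else rcons s z.
Proof.
elim: s => //= x s ->; case: ifP => //= _.
by case: ifP => // _; case: ifP.
Qed.

Lemma has_flip x s : has (fun z => - x < z) (flip s) = has (fun z => z < x) s.
Proof.
rewrite has_rev has_map; apply: eq_has => z /=; exact: ltrN2.
Qed.

Lemma drop_first_gt_flip x s : drop_first_gt (- x) (flip s) = flip (drop_last_lt x s).
Proof.
elim: s => //= y s IH; rewrite flip_cons drop_first_gt_rcons has_flip IH ltrN2.
by case: ifP => _; [rewrite flip_cons | case: ifP => _; rewrite ?flip_cons].
Qed.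

Lemma drop_last_lt_id x s : has (fun z => z < x) s = false -> drop_last_lt x s = s.
Proof. by case: s => //= y s /norP []; do 2 move/negPf ->. Qed.

(** Both orders of pairing leave the same letters over, so the unpaired letters of the second word
    become, after [flip], those of a first word. *)
Lemma unmatched_flip a b : incr_word b ->
  unmatched (flip b) (flip a) = flip (unpaired a b).2.
Proof.
move=> ib; rewrite -pair_revE // /unmatched.
elim: a b {ib} => //= x a IH b.
rewrite flip_cons foldr_rcons drop_first_gt_flip IH.
by case: ifP => //= /drop_last_lt_id ->.
Qed.

Definition epair (a b : seq int) : option (seq int * seq int) :=
  if (unpaired a b).2 is y :: _ then Some (insertw (next_down y a) a, rem y b) else None.

Lemma next_up_flip y a : next_up (- y) (flip a) = - next_down y a.
Proof.
rewrite /next_up /next_down size_flip opprD opprK; congr (_ + Posz _).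
by apply: eq_find => k /=; rewrite mem_flip opprD opprK.
Qed.

Lemma le_sorted_flip s : sorted <=%R s -> sorted <=%R (flip s).
Proof.
move=> h; rewrite /flip rev_sorted (@sorted_map int int -%R).
by apply: sub_sorted h => x y /=; rewrite lerN2.
Qed.

Lemma flip_incr s : incr_word s -> incr_word (flip s).
Proof.
move=> h; rewrite /incr_word /flip rev_sorted (@sorted_map int int -%R).
by apply: sub_sorted h => x y /=; rewrite ltrN2.
Qed.

Lemma flip_insertw y s : flip (insertw y s) = insertw (- y) (flip s).
Proof.
apply: le_sorted_eq; [exact/le_sorted_flip/insertw_sorted|exact: insertw_sorted|].
rewrite /flip /insertw perm_rev (perm_trans (perm_map _ (permEl (perm_sort _ _)))) //.
by rewrite perm_sym perm_sort /= perm_cons perm_rev.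
Qed.

Lemma flip_rem y s : incr_word s -> flip (rem y s) = rem (- y) (flip s).
Proof.
move=> i; apply: lt_sorted_eq.
- by apply: flip_incr; apply: incr_sub i; exact: rem_subseq.
- by apply: incr_sub (flip_incr i); exact: rem_subseq.
move=> x; rewrite mem_flip !mem_rem_uniq ?incr_uniq //; last exact: flip_incr.
by rewrite !inE mem_flip eqr_oppLR.
Qed.

Lemma epair_flip a b : incr_word a -> incr_word b ->
  epair a b = omap (fun cd => (flip cd.2, flip cd.1)) (fpair (flip b) (flip a)).
Proof.
move=> ia ib; have := unmatched_flip a ib; rewrite /epair.
case: (unpaired a b).2 => [|y u].
  by rewrite /fpair unpaired1 => ->.
rewrite flip_cons => /fpair_rcons -> /=; congr Some; congr pair.
  by rewrite flip_insertw flipK next_up_flip opprK.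
by rewrite flip_rem ?flipK ?opprK //; exact: flip_incr.
Qed.

Lemma eop_cat P a b S : eop (size P) (P ++ [:: a, b & S]) =
  omap (fun cd => P ++ [:: cd.1, cd.2 & S]) (epair a b).
Proof.
rewrite /eop /epair !nth_cat ltnn subnn ltnNge leqnSn /= subSnn /=.
case: (unpaired a b).2 => //= x u; congr Some.
by elim: P => //= p P ->.
Qed.

Lemma flip_fact_isFact n w : isFact n w -> isFact n (flip_fact w).
Proof.
move=> [s [al r]]; split; first by rewrite size_rev size_map.
split; last by rewrite flatten_flip; exact: flip_reduced.
rewrite all_rev all_map; apply: sub_all al => a /=; exact: flip_incr.
Qed.

(** With indices from [0], reversal sends the factors [i] and [i.+1] to [n - i.+1] and [n - i.+2];
    the smaller index names the operator. *)
Lemma eop_flip n i w : isFact n w -> (i.+1 < n)%N ->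
  eop i w = omap flip_fact (fop (n - i.+2) (flip_fact w)).
Proof.
move=> fw hi; have [s _] := fw.
have [P [a [b [S [eP ew]]]]] := split_at s hi.
move: fw s; rewrite ew => fw s; have [ia ib _] := isFact_split fw.
rewrite -{1}eP eop_cat epair_flip //.
have ef u v : flip_fact (P ++ [:: u, v & S]) =
    flip_fact S ++ [:: flip v, flip u & flip_fact P].
  by rewrite /flip_fact map_cat rev_cat /= !rev_cons -!cats1 -!catA.
have -> : (n - i.+2 = size (flip_fact S))%N.
  by rewrite size_rev size_map -s -eP size_cat /=; lia.
rewrite ef fop_cat; case: fpair => //= -[c d]; congr Some => /=.
by apply: (can_inj flip_factK); rewrite flip_factK ef !flipK.
Qed.

Lemma eop_isFact n i w v : isFact n w -> (i.+1 < n)%N -> eop i w = Some v -> isFact n v.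
Proof.
move=> fw hi; rewrite (eop_flip fw hi).
case E : fop => [u|] //= [<-]; apply: flip_fact_isFact.
by apply: fop_isFact E; [exact: flip_fact_isFact | lia].
Qed.

Lemma flip_factorwise B n w : ck_natural B -> isFact n w ->
  flip_fact (factorwise B w) = factorwise (fun u => flip (B (flip u))) (flip_fact w).
Proof.
move=> hB [_ [_ r]]; have [e1 e2] := factorwise_flatten hB r.
rewrite -[LHS]flattenK flatten_flip e1 shape_flip e2.
by rewrite /factorwise shape_flip flatten_flip flipK.
Qed.

Lemma eop_factorwise B n i w : ck_natural B -> isFact n w -> (i.+1 < n)%N ->
  eop i (factorwise B w) = omap (factorwise B) (eop i w).
Proof.
move=> hB fw hi; have ff := flip_fact_isFact fw.
rewrite (eop_flip (factorwise_isFact hB fw) hi) (eop_flip fw hi).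
rewrite (flip_factorwise hB fw).
have hj : ((n - i.+2).+1 < n)%N by lia.
rewrite (fop_factorwise (flip_natural hB) ff hj).
case E : (fop _ (flip_fact w)) => [u|] //=; congr Some.
have fu := fop_isFact ff hj E.
by rewrite -[u in LHS]flip_factK -(flip_factorwise hB (flip_fact_isFact fu)) flip_factK.
Qed.

(** * The crystal isomorphism *)

Lemma bump_natural pi : ck_natural (bump pi).
Proof.
split=> *; [exact: bump_reduced | exact: size_bump | exact: bump_descent | exact: bump_ck].
Qed.

(** Transfers string lengths: [omap] sends exactly [None] to [None], so both strings end after the
    same number of steps. *)
Lemma iter_op_map (F : seq (seq int) -> Prop) g h :
  (forall w v, F w -> g w = Some v -> F v) ->
  (forall w, F w -> g (h w) = omap h (g w)) ->
  forall k w, F w -> iter_op g k (h w) = omap h (iter_op g k w).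
Proof.
move=> hF hg k w fw.
have H j v : iter_op g j w = Some v -> F v.
  elim: j v => [v [<-]//|j IH v /=].
  by case E : (iter_op g j w) => [u|] // /hF; apply; exact: IH.
elim: k => //= k ->; case E : (iter_op g k w) => [u|] //=.
by apply: hg; exact: H E.
Qed.

Theorem theorem4p5 (n : nat) (pi : SZ) : (1 <= n)%N ->
  (* b_pi maps the crystal into itself and is a bijection of it *)
  (forall w, isFact n w -> isFact n (bfact pi w)) /\
  (forall w w', isFact n w -> isFact n w' -> bfact pi w = bfact pi w' -> w = w') /\
  (forall v, isFact n v -> exists w, isFact n w /\ bfact pi w = v) /\
  (* preserves weights *)
  (forall w, isFact n w -> wt (bfact pi w) = wt w) /\
  (* preserves string lengths and commutes with e_i, f_i (with 0 |-> 0) *)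
  (forall (i : nat) w, (i.+1 < n)%N -> isFact n w ->
     (forall k, is_eps i (bfact pi w) k <-> is_eps i w k) /\
     (forall k, is_phi i (bfact pi w) k <-> is_phi i w k) /\
     eop i (bfact pi w) = omap (bfact pi) (eop i w) /\
     fop i (bfact pi w) = omap (bfact pi) (fop i w)).
Proof.
move=> _; have hB := bump_natural pi.
have hbf w : isFact n w -> flatten (bfact pi w) = bump pi (flatten w) /\
    shape (bfact pi w) = shape w by case=> _ [_ r]; exact: factorwise_flatten.
split; first by move=> w; exact: factorwise_isFact.
split.
  move=> w w' fw fw' e; have [e1 e2] := hbf w fw; have [e1' e2'] := hbf w' fw'.
  rewrite -[w]flattenK -[w']flattenK -e2 -e2' e; congr reshape.
  case: fw fw' => [_ [_ r]] [_ [_ r']]; apply: (bump_inj (pi := pi) r r').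
  by rewrite -e1 -e1' e.
split.
  (* A preimage of the word is cut at the breaks of [v]; its factors are increasing because the bump
     preserves descents. *)
  move=> v [s [al r]]; have [u [ru eu]] := bump_surj pi r.
  have su : size u = sumn (shape v).
    by rewrite -(size_bump pi ru) eu size_flatten.
  have ef : flatten (reshape (shape v) u) = u by rewrite reshapeKr // su.
  have es : shape (reshape (shape v) u) = shape v by rewrite reshapeKl // su.
  exists (reshape (shape v) u); split; last first.
    by rewrite /bfact -/(shape _) es ef eu flattenK.
  split; first by rewrite -(size_map size) -/shape es size_map.
  split; last by rewrite ef.
  apply: (@incr_reshape _ (flatten v)); last by rewrite flattenK.
    by rewrite -eu size_bump.
  by move=> p; rewrite -eu size_bump // => hp; rewrite bump_descent.
split; first by move=> w /hbf [].
move=> i w hi fw.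
have he u : isFact n u -> eop i (bfact pi u) = omap (bfact pi) (eop i u).
  by move=> fu; exact: eop_factorwise fu hi.
have hf u : isFact n u -> fop i (bfact pi u) = omap (bfact pi) (fop i u).
  by move=> fu; exact: fop_factorwise fu hi.
have ie := iter_op_map (fun u v fu => eop_isFact fu hi) he.
have ip := iter_op_map (fun u v fu => fop_isFact fu hi) hf.
have on x : omap (bfact pi) x = None <-> x = None by case: x.
split; first by move=> k; rewrite /is_eps !ie //;
  split=> -[h1 h2]; split; [move=> /on | exact/on | move=> /on | exact/on].
split; first by move=> k; rewrite /is_phi !ip //;
  split=> -[h1 h2]; split; [move=> /on | exact/on | move=> /on | exact/on].
by split; [exact: he | exact: hf].
Qed.
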